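(* Let $g$ be a left-invariant Einstein metric on $G=\mathrm{SU}(2)\times\mathrm{SU}(2)$. Suppose that $g$ is preserved by an inner involution $\sigma\in\mathrm{Ad}(G)$, $\sigma^2=I$, $\sigma\neq I$, with $\operatorname{tr}\sigma=-2$. Then the subgroup of $\mathrm{Ad}(G)$ preserving $g$ contains a Klein four subgroup that contains $\sigma$: $$\langle\sigma,\tau\rangle\cong\mathbb Z_2\times\mathbb Z_2$$ for some inner involution $\tau$ commuting with $\sigma$.
   Context: A left-invariant metric on $G$ is determined by its inner product $g_e$ on the Lie algebra $\mathfrak g=\mathfrak{su}(2)\oplus\mathfrak{su}(2)$; it is Einstein when $\mathrm{Ric}_g=\lambda g$ for a constant $\lambda$. $\mathrm{Ad}(G)\cong SO(3)\times SO(3)$ is the image of the adjoint representation of $G$ on $\mathfrak g$; its elements are the differentials at the identity of the inner automorphisms $x\mapsto axa^{-1}$. An element of $\mathrm{Ad}(G)$ preserves $g$ if it preserves the inner product $g_e$ (equivalently, the corresponding inner automorphism is an isometry of $g$). An inner involution is a nonidentity element $\sigma\in\mathrm{Ad}(G)$ with $\sigma^2=I$, and $\operatorname{tr}\sigma$ is its trace on the six-dimensional space $\mathfrak g$. *)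

(* Defs.v *)
From HB Require Import structures.
From mathcomp Require Import all_boot all_order all_algebra.
From mathcomp Require Import spectral sesquilinear complex.
From mathcomp Require Import ring lra.
From mathcomp Require Import classical_sets.

Set Implicit Arguments.
Unset Strict Implicit.
Unset Printing Implicit Defensive.

Import Order.TTheory GRing.Theory Num.Theory.

Local Open Scope ring_scope.
Local Open Scope complex_scope.
Local Open Scope sesquilinear_scope.
Local Open Scope classical_set_scope.

Definition lftrace (R : realFieldType) (L : vectType R) (f : L -> L) : R :=
  \sum_(i < \dim {:L}) coord (vbasis {:L}) i (f (vbasis {:L})`_i).

(* Left-invariant Riemannian geometry of a Lie group whose Lie algebra is L,
   with bracket br.  Left-invariant vector fields are identified with elements
   of L, a left-invariant metric with an inner product on L, and the
   Levi-Civita connection with its values on left-invariant fields, which are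
   again left-invariant; these values determine it. *)
Section LeftInvariant.
Variables (R : realFieldType) (L : vectType R) (br : L -> L -> L).
Implicit Types (g : {dot L for idfun}) (D : {bilinear L -> L -> L}).

(* Metric compatibility has no term X (g Y Z): the metric is constant on
   left-invariant fields. *)
Record is_levi_civita g D : Prop := IsLeviCivita {
  levi_civita_torsion_free : forall X Y, D X Y - D Y X = br X Y;
  levi_civita_metric : forall X Y Z, g (D X Y) Z + g Y (D X Z) = 0
}.

Definition curvature D (X Y Z : L) : L :=
  D X (D Y Z) - D Y (D X Z) - D (br X Y) Z.

Definition ricci D (X Y : L) : R := lftrace (fun Z => curvature D Z X Y).

(* The connection exists and is unique: see levi_civita_exists and
   levi_civita_unique below, for any alternating bracket. *)
Definition is_einstein g : Prop :=
  exists2 D, is_levi_civita g D &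
    exists lambda : R, forall X Y, ricci D X Y = lambda * g X Y.

Definition preserves_metric g (f : L -> L) : Prop :=
  forall X Y, g (f X) (f Y) = g X Y.

End LeftInvariant.

Section LeviCivita.
Variables (R : realFieldType) (L : vectType R) (br : {bilinear L -> L -> L}).
Hypothesis brC : forall X Y, br X Y = - br Y X.
Variable g : {dot L for idfun}.

Let gC X Y : g X Y = g Y X.
Proof. by rewrite (hermitian_subproof X Y) expr0 mul1r. Qed.

Let gPl Z : scalar (g^~ Z).
Proof. by move=> a X Y; rewrite linearPl. Qed.

Let gPr Z : scalar (g Z).
Proof. by move=> a X Y; rewrite ![g Z _]gC linearPl. Qed.

Let gBl Z : {morph g^~ Z : X Y / X - Y}.
Proof. by move=> X Y; rewrite linearBl. Qed.

Let gNl Z X : g (- X) Z = - g X Z.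
Proof. by rewrite linearNl. Qed.

Let g_inj X Y : (forall Z, g X Z = g Y Z) -> X = Y.
Proof.
move=> h; apply/eqP; rewrite -subr_eq0; apply/negPn/negP.
by move=> /(@neq0_dnorm_gt0 _ _ _ g); rewrite gBl h subrr ltxx.
Qed.

Let n := \dim {:L}.
Let b := vbasis {:L}.

Let linear_ext (F F' : L -> R) : scalar F -> scalar F' ->
  (forall i : 'I_n, F b`_i = F' b`_i) -> F =1 F'.
Proof.
move=> lF lF' h X; rewrite (coord_vbasis (memvf X)).
pose P (Y : L) := F Y = F' Y.
apply: (big_ind P) => [||i _].
- by have := lF (-1) 0 0; have := lF' (-1) 0 0;
     rewrite /P !scaler0 !addr0 !mulN1r !addNr => -> ->.
- move=> U V hU hV; rewrite /P -[U]scale1r lF lF' -/(P V) hV.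
  by congr (_ * _ + _).
- by rewrite /P -[_ *: _]addr0 lF lF' h; congr (_ + _);
     have := lF (-1) 0 0; have := lF' (-1) 0 0;
     rewrite /P !scaler0 !addr0 !mulN1r !addNr => -> ->.
Qed.

Let flat_fun (X : L) : 'rV[R]_n := \row_i g X b`_i.
Let flat_linear : linear flat_fun.
Proof. by move=> a X Y; apply/rowP => i; rewrite !mxE gPl. Qed.
HB.instance Definition _ :=
  GRing.isLinear.Build R L 'rV[R]_n _ flat_fun flat_linear.
Let flat := linfun flat_fun.

Let flatE X i : flat X 0 i = g X b`_i.
Proof. by rewrite lfunE mxE. Qed.

Let flat_ker : lker flat == 0%VS.
Proof.
apply/lker0P => X Y e; apply: g_inj.
by apply: linear_ext => // i; rewrite -!flatE e.
Qed.

Let flat_img : limg flat = fullv.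
Proof.
apply/eqP; rewrite eqEdim subvf /= limg_dim_eq ?(eqP flat_ker) ?capv0 //.
by rewrite [X in (X <= _)%N]dimvf /dim /= mul1n.
Qed.

Let sharp (v : 'rV[R]_n) : L := (flat^-1)%VF v.

Let sharpE v (i : 'I_n) : g (sharp v) b`_i = v 0 i.
Proof. by rewrite -flatE /sharp limg_lfunVK // flat_img memvf. Qed.

Let koszul (X Y Z : L) : R :=
  (g (br X Y) Z - g (br Y Z) X + g (br Z X) Y) / 2%:R.

Let koszul_lin1 Y Z : scalar (fun X => koszul X Y Z).
Proof.
move=> a X X'; rewrite /koszul [br (_ + _) _]linearPl [br Z _]linearPr !gPl gPr.
by field.
Qed.

Let koszul_lin2 X Z : scalar (fun Y => koszul X Y Z).
Proof.
move=> a Y Y'; rewrite /koszul [br (_ + _) _]linearPl [br X _]linearPr !gPl gPr.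
by field.
Qed.

Let koszul_lin3 X Y : scalar (koszul X Y).
Proof.
move=> a Z Z'; rewrite /koszul [br (_ + _) _]linearPl [br Y _]linearPr !gPl gPr.
by field.
Qed.

Let nabla X Y := sharp (\row_i koszul X Y b`_i).

Let nablaE X Y Z : g (nabla X Y) Z = koszul X Y Z.
Proof.
by move: Z; apply: linear_ext => // i; rewrite sharpE mxE.
Qed.

Let nabla_bilinear : bilinear_for *:%R *:%R nabla.
Proof.
split=> [Y a X X'|X a Y Y']; apply: g_inj => Z; rewrite gPl !nablaE.
  exact: koszul_lin1.
exact: koszul_lin2.
Qed.
HB.instance Definition _ :=
  bilinear_isBilinear.Build R L L L _ _ nabla nabla_bilinear.

Lemma levi_civita_exists : exists D, is_levi_civita br g D.
Proof.
exists nabla; split=> [X Y|X Y Z].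
  apply: g_inj => Z; rewrite gBl !nablaE /koszul.
  by rewrite [br Y X]brC [br X Z]brC [br Z Y]brC !gNl; field.
rewrite [g Y _]gC !nablaE /koszul.
by rewrite [br Z Y]brC [br Y X]brC [br X Z]brC !gNl; field.
Qed.

Lemma levi_civita_unique D D' :
  is_levi_civita br g D -> is_levi_civita br g D' -> D =2 D'.
Proof.
suff K D0 : is_levi_civita br g D0 -> forall X Y Z, g (D0 X Y) Z = koszul X Y Z.
  by move=> h h' X Y; apply: g_inj => Z; rewrite !K.
move=> [ht hm] X Y Z; rewrite /koszul -!ht !gBl.
have := hm X Y Z; have := hm Y Z X; have := hm Z X Y.
rewrite [g Y (D0 X Z)]gC [g Z (D0 Y X)]gC [g X (D0 Z Y)]gC => *; lra.
Qed.

End LeviCivita.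

Section KleinFour.
Variables (R : realFieldType) (L : vectType R).

(* The subgroup of GL(L) generated by A, when A consists of automorphisms
   (f^-1%VF is the inverse of f when f is bijective). *)
Inductive generated (A : set 'End(L)) : set 'End(L) :=
  | generated_in f : A f -> generated A f
  | generated_id : generated A \1%VF
  | generated_comp f h :
      generated A f -> generated A h -> generated A (f \o h)%VF
  | generated_inv f : generated A f -> generated A (f^-1)%VF.

Definition klein_four (K : set 'End(L)) : Prop :=
  exists phi : 'Z_2 * 'Z_2 -> 'End(L),
    [/\ injective phi,
        forall x y, phi (x + y) = (phi x \o phi y)%VF &
        range phi = K].

End KleinFour.

Section SU2.
Variable R : rcfType.
Local Notation C := R[i].

Definition SU2_pred : {pred 'M[C]_2} :=
  [pred A | (A \is unitarymx) && (\det A == 1)].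
Record SU2 := MkSU2 { SU2val :> 'M[C]_2; SU2valP : SU2val \in SU2_pred }.

Definition su2_pred : {pred 'M[C]_2} :=
  [pred X : 'M[C]_2 | (X ^t* == - X) && (\tr X == 0)].

Lemma su2_predP (X : 'M[C]_2) :
  reflect (X ^t* = - X /\ \tr X = 0) (X \in su2_pred).
Proof. by apply: (iffP andP) => [[/eqP ? /eqP ?]|[? ?]]; split => //; apply/eqP. Qed.

Lemma su2_zmod_closed : zmod_closed su2_pred.
Proof.
split=> [|X Y /su2_predP[hX tX] /su2_predP[hY tY]]; apply/su2_predP.
  by rewrite trmx0 map_mx0 oppr0 mxtrace0.
split; last by rewrite raddfB /= tX tY subr0.
by rewrite raddfB /= map_mxB hX hY opprB opprK addrC.
Qed.
HB.instance Definition _ := GRing.isZmodClosed.Build 'M[C]_2 su2_pred su2_zmod_closed.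

Record su2 := MkSu2 { su2val :> 'M[C]_2; su2valP : su2val \in su2_pred }.
HB.instance Definition _ := [isSub for su2val].
HB.instance Definition _ := [Choice of su2 by <:].
HB.instance Definition _ := [SubChoice_isSubZmodule of su2 by <:].

Lemma scale_su2_subproof (a : R) (X : su2) : a%:C *: su2val X \in su2_pred.
Proof.
have /su2_predP[hX tX] := su2valP X; apply/su2_predP.
rewrite linearZ /= map_mxZ hX mxtraceZ tX mulr0 scalerN; split => //.
by congr (- (_ *: _)); exact: conjc_real.
Qed.
Definition scale_su2 a X := MkSu2 (scale_su2_subproof a X).

Lemma scale_su2A a b X : scale_su2 a (scale_su2 b X) = scale_su2 (a * b) X.
Proof. by apply: val_inj; rewrite /= scalerA rmorphM. Qed.
Lemma scale_su21 : left_id 1 scale_su2.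
Proof. by move=> X; apply: val_inj; rewrite /= scale1r. Qed.
Lemma scale_su2Dr : right_distributive scale_su2 +%R.
Proof. by move=> a X Y; apply: val_inj; rewrite /= scalerDr. Qed.
Lemma scale_su2Dl X : {morph scale_su2^~ X : a b / a + b}.
Proof. by move=> a b; apply: val_inj; rewrite /= rmorphD /= scalerDl. Qed.
HB.instance Definition _ := GRing.Zmodule_isLmodule.Build R su2
  scale_su2A scale_su21 scale_su2Dr scale_su2Dl.

(* X = [[i x, y + i z], [- y + i z, - i x]] has coordinates (x, y, z). *)
Definition su2_coord (X : su2) : 'rV[R]_3 :=
  \row_j [:: complex.Im (X 0 0); complex.Re (X 0 1); complex.Im (X 0 1)]`_j.
Definition mx_of_coord (v : 'rV[R]_3) : 'M[C]_2 :=
  \matrix_(i, j)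
    (if i == 0 then if j == 0 then 0 +i* v 0 0 else v 0 1 +i* v 0 2%:R
     else if j == 0 then (- v 0 1) +i* v 0 2%:R else 0 +i* (- v 0 0)).

Lemma mx_of_coord_su2 v : mx_of_coord v \in su2_pred.
Proof.
apply/su2_predP; split; last first.
  by rewrite /mxtrace !big_ord_recr big_ord0 /= !mxE /= !add0r; apply/eqP;
     rewrite eq_complex /= addr0 subrr eqxx.
by apply/matrixP => i j; rewrite !mxE; case: i j => [[|[|//]] ?] [[|[|//]] ?] /=;
   apply/eqP; rewrite eq_complex /= ?oppr0 ?opprK !eqxx.
Qed.

Lemma su2_coord_linear : linear su2_coord.
Proof.
move=> a X Y; apply/rowP => -[[|[|[|//]]] ?]; rewrite !mxE /= ?mxE /=;
  by case: (su2val X _ _) (su2val Y _ _) => [? ?] [? ?] /=; rewrite ?mul0r ?subr0 ?addr0.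
Qed.

Lemma mx_of_coordK : cancel su2_coord (fun v => MkSu2 (mx_of_coord_su2 v)).
Proof.
move=> X; apply: val_inj => /=; have /su2_predP[hX tX] := su2valP X.
apply/matrixP => i j; rewrite !mxE /=.
have e00 := congr1 (fun A : 'M_2 => A 0 0) hX.
have e01 := congr1 (fun A : 'M_2 => A 0 1) hX.
move: tX e00 e01; rewrite /mxtrace !big_ord_recr big_ord0 /= add0r !mxE.
have -> : widen_ord (leqnSn 1) ord_max = 0 :> 'I_2 by exact: val_inj.
have -> : ord_max = 1 :> 'I_2 by exact: val_inj.
have -> : i = if i == 0 then 0 else 1.
  by case: i => [[|[|//]] ?]; apply: val_inj.
have -> : j = if j == 0 then 0 else 1.
  by case: j => [[|[|//]] ?]; apply: val_inj.
case: (i == 0); case: (j == 0) => /=;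
  case: (su2val X 0 0) (su2val X 0 1) (su2val X 1 0) (su2val X 1 1)
    => [a b] [c d] [e f] [p q] /eqP;
  rewrite eq_complex /= => /andP[/eqP h1 /eqP h2] /eqP;
  rewrite eq_complex /= => /andP[/eqP h3 _] /eqP;
  rewrite eq_complex /= => /andP[/eqP h4 /eqP h5];
  by apply/eqP; rewrite eq_complex /=; apply/andP; split; apply/eqP; lra.
Qed.

Lemma su2_coordK : cancel (fun v => MkSu2 (mx_of_coord_su2 v)) su2_coord.
Proof.
by move=> v; apply/rowP => -[[|[|[|//]]] ?]; rewrite !mxE /= ?mxE /=;
   congr (v _ _); apply: val_inj.
Qed.

Lemma su2_vector_axiom : Vector.axiom 3 su2.
Proof.
exists su2_coord; first exact: su2_coord_linear.
by exists (fun v => MkSu2 (mx_of_coord_su2 v)); [exact: mx_of_coordK|exact: su2_coordK].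
Qed.
HB.instance Definition _ := Lmodule_hasFinDim.Build R su2 su2_vector_axiom.

Lemma su2_lie_subproof (X Y : su2) : X *m Y - Y *m X \in su2_pred.
Proof.
have /su2_predP[hX _] := su2valP X; have /su2_predP[hY _] := su2valP Y.
apply/su2_predP; rewrite raddfB /= map_mxB !trmx_mul !map_mxM hX hY.
by rewrite !mulNmx !mulmxN !opprK opprB raddfB /= mxtrace_mulC subrr.
Qed.
Definition su2_lie (X Y : su2) : su2 := MkSu2 (su2_lie_subproof X Y).

Lemma su2_lie_linearl Y : linear (su2_lie^~ Y).
Proof.
move=> a X X'; apply: val_inj; rewrite /= mulmxDl mulmxDr.
by rewrite -scalemxAl -scalemxAr scalerBr opprD addrACA.
Qed.
Lemma su2_lie_linearr X : linear (su2_lie X).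
Proof.
move=> a Y Y'; apply: val_inj; rewrite /= mulmxDl mulmxDr.
by rewrite -scalemxAl -scalemxAr scalerBr opprD addrACA.
Qed.

Lemma su2_Ad_subproof (a : SU2) (X : su2) : a *m X *m invmx a \in su2_pred.
Proof.
have /andP[ua _] := SU2valP a; have /su2_predP[hX tX] := su2valP X.
apply/su2_predP; rewrite mxtrace_mulC mulmxA mulVmx ?unitarymx_unit// mul1mx tX.
split=> //; rewrite invmx_unitary// !trmx_mul !map_mxM hX trmxCK.
by rewrite mulNmx mulmxN mulmxA.
Qed.
Definition su2_Ad (a : SU2) (X : su2) : su2 := MkSu2 (su2_Ad_subproof a X).

Lemma su2_Ad_linear a : linear (su2_Ad a).
Proof.
move=> k X Y; apply: val_inj; rewrite /= mulmxDr mulmxDl.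
by rewrite -scalemxAr -scalemxAl.
Qed.

Definition grpG : Type := (SU2 * SU2)%type.
Definition lieG : vectType R := (su2 * su2)%type.

Definition lieG_bracket (X Y : lieG) : lieG :=
  (su2_lie X.1 Y.1, su2_lie X.2 Y.2).

Lemma lieG_bracket_bilinear : bilinear_for *:%R *:%R lieG_bracket.
Proof.
by split=> [Y a X X'|X a Y Y']; congr pair;
   (exact: su2_lie_linearl || exact: su2_lie_linearr).
Qed.
HB.instance Definition _ :=
  bilinear_isBilinear.Build R lieG lieG lieG _ _ lieG_bracket
    lieG_bracket_bilinear.

Lemma lieG_bracketC X Y : lieG_bracket X Y = - lieG_bracket Y X.
Proof. by congr pair; apply: val_inj; rewrite /= opprB. Qed.

Lemma lieG_levi_civita (g : {dot lieG for idfun}) :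
  exists D, is_levi_civita lieG_bracket g D.
Proof. exact: (levi_civita_exists lieG_bracketC). Qed.

Lemma dim_lieG : \dim {:lieG} = 6%N.
Proof. by rewrite dimvf. Qed.

Definition Ad (a : grpG) (X : lieG) : lieG :=
  (su2_Ad a.1 X.1, su2_Ad a.2 X.2).

Lemma Ad_linear a : linear (Ad a).
Proof.
by move=> k X Y; congr pair; exact: su2_Ad_linear.
Qed.
HB.instance Definition _ a :=
  GRing.isLinear.Build R lieG lieG _ (Ad a) (Ad_linear a).

Definition AdG : set 'End(lieG) := range (fun a : grpG => linfun (Ad a)).

Definition inner_involution (f : 'End(lieG)) : Prop :=
  [/\ AdG f, (f \o f)%VF = \1%VF & f != \1%VF].

Definition AdG_preserving (g : {dot lieG for idfun}) : set 'End(lieG) :=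
  [set f | AdG f /\ preserves_metric g f].

End SU2.

(* Main.v *)
Require Import Defs.
From mathcomp Require Import all_boot all_order all_algebra.
From mathcomp Require Import spectral sesquilinear complex classical_sets reals.
From mathcomp Require Import topology normedtype derive.
From mathcomp Require Import ring lra.

Set Implicit Arguments.
Unset Strict Implicit.
Unset Printing Implicit Defensive.

Import Order.TTheory GRing.Theory Num.Theory numFieldNormedType.Exports.

Local Open Scope ring_scope.
Local Open Scope complex_scope.
Local Open Scope sesquilinear_scope.
Local Open Scope classical_set_scope.

(** The involution [sigma] is a pair of half turns about unit vectors e1, f1 of
    the two copies of su(2): Ad of a quaternion t + v is involutive only if it
    is trivial or t = 0 ([su2_Ad_involutive]), and among the pairs so obtained
    only two genuine half turns have trace -2.  Hence su(2) + su(2) is the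
    g-orthogonal sum of the plane V+ spanned by E1, F1, where [sigma] = 1, and
    of the space V- spanned by E2, E3, F2, F3, where [sigma] = -1; here e1, e2,
    e3 and f1, f2, f3 are quaternionic frames, and (e2, e3), (f2, f3) may still
    be rotated in their planes.  By the singular value decomposition of a 2 x 2
    matrix ([svd2]) these rotations achieve g(E2, F3) = g(E3, F2) = 0.  If also
    g(E2, E3) = g(F2, F3) = 0, then the half turns tau about (e2, f2) preserve
    g, and [sigma] and tau generate a Klein four group.  So the point is that
    the Einstein equation forces these two numbers to vanish
    ([einstein_frame_diagonal]).

    On a unimodular Lie algebra Ric(X, Y) is minus the trace of the map
    Z |-> D_{D_Z X} Y ([ricciE]).  For X, Y in V- this trace can be written with
    the skew operators D_T alone, T in an orthonormal basis of V+
    ([ricci_split]).  Let w_Y be the vector with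
    g(w_Y, -) = <Y, ->, where < , > is the bi-invariant inner product.  For
    (X, Y) = (w_E2, w_E3), and likewise for (w_F2, w_F3), the terms of Ric(X, Y)
    that are linear in D_T cancel because D_T is skew and ad_T exchanges the
    lines of E2 and E3, and the Einstein equation becomes
      lambda g(X, Y) + 2 sum_T g(D_T X, D_T Y) = 0.
    Add these two equations with weights g(E2, E3) and g(F2, F3).  In
    orthonormal bases v1, v2 of the plane (E2, F2) and v1', v2' of the plane
    (E3, F3) with g(v1, v2') = g(v2, v1') = 0 ([principal_bases]) and with
    x = g(v1, v1'), y = g(v2, v2'), the lambda-term of the sum is
      - lambda (x^2 / (1 - x^2) + y^2 / (1 - y^2)),
    while each T contributes a nonpositive number ([principal_sum_le0]); this
    uses that g(D_T E2, F2) = g(D_T E3, F3) = 0.  If lambda > 0, then x = y = 0,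
    so the two planes are orthogonal.

    Finally lambda > 0 ([einstein_const_gt0]): if u is an eigenvector of g with
    respect to < , > for the largest eigenvalue, the right-invariant vector
    field with value u is a Killing field whose length is maximal at the
    identity, and the Bochner formula gives Ric(u, u) > 0
    ([ricci_gt0_at_max]). *)

(** * Inner products, orthonormal bases and traces *)

Section Unbundled.
Variables (R : nzRingType) (U V : lmodType R).

Lemma linear_at0 (f : U -> V) : linear f -> f 0 = 0.
Proof.
by move=> fl; have := fl (-1) 0 0; rewrite scaler0 addr0 scaleN1r addNr.
Qed.

Lemma linear_sum_scale (f : U -> V) I r (P : pred I) (a : I -> R) (x : I -> U) :
  linear f ->
  f (\sum_(i <- r | P i) a i *: x i) = \sum_(i <- r | P i) a i *: f (x i).
Proof.
move=> fl; apply: (big_ind2 (fun u v => f u = v)) => [|u v u' v' h h'|i _].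
- exact: linear_at0.
- by rewrite -[u]scale1r fl scale1r h h'.
- by rewrite -[X in f X]addr0 fl linear_at0 // addr0.
Qed.

Lemma scalar_at0 (f : U -> R) : scalar f -> f 0 = 0.
Proof.
by move=> fl; have := fl (-1) 0 0; rewrite scaler0 addr0 mulN1r addNr.
Qed.

Lemma scalar_sum_scale (f : U -> R) I r (P : pred I) (a : I -> R) (x : I -> U) :
  scalar f ->
  f (\sum_(i <- r | P i) a i *: x i) = \sum_(i <- r | P i) a i * f (x i).
Proof.
move=> fl; apply: (big_ind2 (fun u v => f u = v)) => [|u v u' v' h h'|i _].
- exact: scalar_at0.
- by rewrite -[u]scale1r fl mul1r h h'.
- by rewrite -[X in f X]addr0 fl scalar_at0 // addr0.
Qed.

End Unbundled.

Section Dot.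
Variables (R : realFieldType) (L : vectType R) (g : {dot L for idfun}).

Lemma dotC X Y : g X Y = g Y X.
Proof. by rewrite (hermitian_subproof X Y) expr0 mul1r. Qed.
Lemma dotDl X Y Z : g (X + Y) Z = g X Z + g Y Z.
Proof. by rewrite linearDl. Qed.
Lemma dotZl a X Z : g (a *: X) Z = a * g X Z.
Proof. by rewrite linearZl_LR. Qed.
Lemma dotNl X Z : g (- X) Z = - g X Z.
Proof. by rewrite linearNl. Qed.
Lemma dotDr X Y Z : g Z (X + Y) = g Z X + g Z Y.
Proof. by rewrite dotC dotDl !(dotC _ Z). Qed.
Lemma dotZr a X Z : g Z (a *: X) = a * g Z X.
Proof. by rewrite dotC dotZl dotC. Qed.
Lemma dotNr X Z : g Z (- X) = - g Z X.
Proof. by rewrite dotC dotNl dotC. Qed.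
Lemma dot0l Z : g 0 Z = 0.
Proof. by rewrite -(scale0r 0) dotZl mul0r. Qed.
Lemma dot0r Z : g Z 0 = 0.
Proof. by rewrite dotC dot0l. Qed.
Lemma dot_suml I r (P : pred I) (F : I -> L) Z :
  g (\sum_(i <- r | P i) F i) Z = \sum_(i <- r | P i) g (F i) Z.
Proof. by apply: (big_morph (g^~ Z)) => [X Y|]; rewrite ?dotDl ?dot0l. Qed.
Lemma dot_sumr I r (P : pred I) (F : I -> L) Z :
  g Z (\sum_(i <- r | P i) F i) = \sum_(i <- r | P i) g Z (F i).
Proof. by rewrite dotC dot_suml; apply: eq_bigr => i _; rewrite dotC. Qed.
Lemma dot_gt0 X : X != 0 -> 0 < g X X.
Proof. exact: neq0_dnorm_gt0. Qed.
Lemma dot_ge0 X : 0 <= g X X.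
Proof. by have [->|/dot_gt0/ltW//] := eqVneq X 0; rewrite dot0l. Qed.
Lemma dot_inj X Y : (forall Z, g X Z = g Y Z) -> X = Y.
Proof.
move=> h; apply/eqP; rewrite -subr_eq0; apply/negPn/negP => /dot_gt0.
by rewrite dotDl dotNl h subrr ltxx.
Qed.

Definition dotE := (dotDl, dotDr, dotZl, dotZr, dotNl, dotNr, dot0l, dot0r).

(** The matrix of f in a basis b is the product of the matrices b -> u -> b
    through the spanning family u; commuting the two factors leaves the sum
    over u.  So the family may be any for which the c i are coefficients. *)
Lemma lftrace_dual n (u : 'I_n -> L) (c : 'I_n -> L -> R) (f : L -> L) :
    (forall i, scalar (c i)) -> linear f ->
    (forall v, v = \sum_i c i v *: u i) ->
  lftrace f = \sum_i c i (f (u i)).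
Proof.
move=> cl fl uE; pose b := vbasis {:L}.
have -> : lftrace f = \sum_(i < \dim {:L}) \sum_j c j b`_i * coord b i (f (u j)).
  rewrite /lftrace; apply: eq_bigr => i _.
  rewrite [X in f X]uE linear_sum_scale // linear_sum; apply: eq_bigr => j _.
  by rewrite linearZ.
rewrite exchange_big; apply: eq_bigr => i _ /=.
rewrite [f (u i)](coord_vbasis (memvf _)) scalar_sum_scale //.
by apply: eq_bigr => j _; rewrite -coord_vbasis ?memvf // mulrC.
Qed.

Section Onb.
Variables (n : nat) (e : 'I_n -> L).
Hypothesis eE : forall v, v = \sum_i g v (e i) *: e i.

Lemma parseval v w : g v w = \sum_i g v (e i) * g w (e i).
Proof.
rewrite {1}(eE v) dot_suml; apply: eq_bigr => i _.
by rewrite dotZl (dotC _ w).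
Qed.

Lemma lftrace_onb f : linear f -> lftrace f = \sum_i g (f (e i)) (e i).
Proof.
move=> fl; apply: (@lftrace_dual n e (fun i v => g v (e i))) => // i a X Y.
by rewrite dotDl dotZl.
Qed.

Lemma trace_mulC f h : linear f -> linear h ->
  \sum_i g (f (h (e i))) (e i) = \sum_i g (h (f (e i))) (e i).
Proof.
move=> fl hl.
have key f1 h1 : linear f1 ->
    \sum_i g (f1 (h1 (e i))) (e i)
      = \sum_i \sum_j g (h1 (e i)) (e j) * g (f1 (e j)) (e i).
  move=> f1l; apply: eq_bigr => i _; rewrite {1}(eE (h1 (e i))).
  rewrite linear_sum_scale // dot_suml.
  by apply: eq_bigr => j _; rewrite dotZl.
rewrite (key f h) // (key h f) // exchange_big; apply: eq_bigr => i _; apply: eq_bigr => j _.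
by rewrite mulrC.
Qed.

End Onb.

Lemma onb_expand n (e : 'I_n -> L) : n = \dim {:L} ->
  (forall i j, g (e i) (e j) = (i == j)%:R) ->
  forall v, v = \sum_i g v (e i) *: e i.
Proof.
move=> nE; subst n => eo.
pose X := [tuple e i | i < \dim {:L}].
have XE (i : 'I_(\dim {:L})) : X`_i = e i by rewrite -tnth_nth tnth_mktuple.
have fX : free X.
  apply/freeP => k kX i.
  have := congr1 (g^~ (e i)) kX; rewrite dot_suml dot0l (bigD1 i) //=.
  rewrite XE dotZl eo eqxx mulr1 big1 ?addr0 // => j ji.
  by rewrite XE dotZl eo (negPf ji) mulr0.
have bX : basis_of {:L} X by rewrite basisEfree fX subvf size_tuple leqnn.
move=> v; rewrite {1}(coord_basis bX (memvf v)); apply: eq_bigr => i _.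
rewrite XE {2}(coord_basis bX (memvf v)) dot_suml (bigD1 i) //= XE dotZl eo eqxx.
by rewrite mulr1 big1 ?addr0 // => j ji; rewrite XE dotZl eo (negPf ji) mulr0.
Qed.

End Dot.

(** * The Ricci tensor of a left-invariant metric *)

Section Ricci.
Variables (R : realFieldType) (L : vectType R) (br : {bilinear L -> L -> L}).
Variables (g : {dot L for idfun}) (D : {bilinear L -> L -> L}).
Hypothesis brC : forall X Y, br X Y = - br Y X.
Hypothesis lc : is_levi_civita br g D.

Lemma lcDr X Y Z : D X (Y + Z) = D X Y + D X Z. Proof. exact: linearDr. Qed.
Lemma lcZl a X Z : D (a *: X) Z = a *: D X Z. Proof. exact: linearZl_LR. Qed.
Lemma lcZr a X Z : D X (a *: Z) = a *: D X Z. Proof. exact: linearZr_LR. Qed.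

Lemma lc_skew X Y Z : g (D X Y) Z = - g Y (D X Z).
Proof. by apply/eqP; rewrite -addr_eq0 (levi_civita_metric lc). Qed.

Lemma lc_skew0 X Y : g (D X Y) Y = 0.
Proof. by have := lc_skew X Y Y; rewrite (dotC g Y); lra. Qed.

Lemma lc_tor X Y : D X Y = D Y X + br X Y.
Proof. by rewrite -(levi_civita_torsion_free lc) addrC subrK. Qed.

Lemma koszul X Y Z :
  2%:R * g (D X Y) Z = g (br X Y) Z - g (br Y Z) X + g (br Z X) Y.
Proof.
have tf := levi_civita_torsion_free lc.
rewrite -!tf !dotE.
have := lc_skew X Y Z; have := lc_skew Y X Z; have := lc_skew Z X Y.
rewrite !(dotC g _ (D _ _)) => *; lra.
Qed.

Variables (n : nat) (e : 'I_n -> L).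
Hypothesis eE : forall v, v = \sum_i g v (e i) *: e i.
Hypothesis unimodular : forall V, lftrace (br V) = 0.

(** The divergence of the left-invariant field W is minus the trace of ad W. *)
Lemma div_free W : \sum_i g (D (e i) W) (e i) = 0.
Proof.
have h V : \sum_i g (D (e i) V) (e i) = - \sum_i g (br V (e i)) (e i).
  rewrite -sumrN; apply: eq_bigr => i _.
  by rewrite lc_tor dotDl lc_skew0 add0r brC dotNl.
rewrite h -(lftrace_onb eE) ?unimodular ?oppr0 // => a X Y.
by rewrite linearPr.
Qed.

(** The term with D X Y in the trace of the curvature is a divergence, so it
    vanishes; torsion-freeness turns the other two into the trace below and the
    trace of a commutator, that of D X and Z |-> D Z Y. *)
Lemma ricciE X Y : ricci br D X Y = - \sum_i g (D (D (e i) X) Y) (e i).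
Proof.
rewrite /ricci (lftrace_onb eE); last first.
  move=> a Z Z'; rewrite /curvature linearPl.
  rewrite [D (a *: Z + Z') Y]linearPl [D X (_ + _)]linearPr.
  rewrite [br (_ + _) X]linearPl [D (a *: br Z X + _) Y]linearPl.
  rewrite !scalerBr !opprD -[RHS]addrACA; congr (_ + _).
  exact: addrACA.
rewrite /curvature.
under eq_bigr do rewrite !dotDl !dotNl.
rewrite !big_split /= div_free add0r !sumrN.
under [X in _ - X]eq_bigr => i _ do
  rewrite -(levi_civita_torsion_free lc) linearBl /= dotDl dotNl.
rewrite big_split /= sumrN.
rewrite (@trace_mulC _ _ _ _ _ eE (fun Z => D Z Y) (D X)); first by ring.
- by move=> a U V; rewrite linearPl.
- by move=> a U V; rewrite linearPr.
Qed.

End Ricci.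

Section RicciFormulas.
Variables (R : realFieldType) (L : vectType R) (br : {bilinear L -> L -> L}).
Variables (g : {dot L for idfun}) (D : {bilinear L -> L -> L}).
Hypothesis brC : forall X Y, br X Y = - br Y X.
Hypothesis lc : is_levi_civita br g D.
Variables (n : nat) (e : 'I_n -> L).
Hypothesis eE : forall v, v = \sum_i g v (e i) *: e i.
Hypothesis unimodular : forall V, lftrace (br V) = 0.

Lemma lc_suml I r (P : pred I) (F : I -> L) Z :
  D (\sum_(i <- r | P i) F i) Z = \sum_(i <- r | P i) D (F i) Z.
Proof.
apply: (big_morph (D^~ Z)) => [X Y|]; first exact: linearDl.
exact: linear0l.
Qed.

(** Bochner's formula at the identity for the Killing field K which is
    right-invariant with value u.  As K commutes with left-invariant fields, its
    covariant derivative is v |-> D u v, and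
      Ric(u, u) = sum_i |D u e_i|^2 + sum_i (x q - g)([u, e_i], [u, e_i]),
    where the second sum is minus the Laplacian of |K|^2 / 2.  If both sums
    vanish, the Koszul formula leaves no room for a negative value of
    tr (ad u)^2. *)
Lemma ricci_gt0_at_max (q : L -> L -> R) (x : R) (u : L) :
    (forall X Y, q X (- Y) = - q X Y) -> (forall X Y, q X Y = q Y X) ->
    (forall X Y Z, q (br X Y) Z = - q Y (br X Z)) ->
    (forall v, g v v <= x * q v v) -> (forall v, g u v = x * q u v) ->
    lftrace (fun v => br u (br u v)) < 0 ->
  0 < ricci br D u u.
Proof.
move=> qN qC qad gq gu ku.
have al : linear (br u) by move=> a X Y; rewrite linearPr.
have Al : linear (D u) by move=> a X Y; rewrite linearPr.
have aal : linear (fun v => br u (br u v)).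
  by move=> a X Y; rewrite linearPr /= linearPr.
pose a := br u; pose A := D u.
have aB X Y : a (X - Y) = a X - a Y by exact: linearBr.
have AB X Y : A (X - Y) = A X - A Y by exact: linearBr.
have uad v : g (br v (a v)) u = x * q (a v) (a v).
  by rewrite dotC gu qC qad [br v u]brC qN opprK.
have k1 i : 2%:R * g (A (a (e i))) (e i) =
    g (a (a (e i))) (e i) + (x * q (a (e i)) (a (e i)) - g (a (e i)) (a (e i))).
  rewrite (koszul lc) [br (a (e i)) (e i)]brC [br (e i) u]brC !dotNl uad.
  by rewrite -/(a _); ring.
have k2 i : 2%:R * g (A (e i)) (a (e i)) =
    g (a (e i)) (a (e i)) - x * q (a (e i)) (a (e i)) - g (a (a (e i))) (e i).
  by rewrite (koszul lc) uad [br (a (e i)) u]brC dotNl.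
have ricE : ricci br D u u = \sum_i (g (A (e i)) (A (e i)) +
    (x * q (a (e i)) (a (e i)) - g (a (e i)) (a (e i)))).
  rewrite (ricciE brC lc eE unimodular).
  have -> : \sum_i g (D (D (e i) u) u) (e i) = \sum_i
     (g (A (A (e i))) (e i) - g (a (A (e i))) (e i) - g (A (a (e i))) (e i)
       + g (a (a (e i))) (e i)).
    apply: eq_bigr => i _; set z := D (e i) u.
    have -> : D z u = A z - a z by rewrite (lc_tor lc z) [br z u]brC.
    have -> : z = A (e i) - a (e i) by rewrite /z (lc_tor lc (e i)) [br _ u]brC.
    by rewrite aB AB !dotE; ring.
  rewrite !big_split /= !sumrN (trace_mulC eE al Al) -/A -/a.
  have -> : \sum_i g (A (A (e i))) (e i) = - \sum_i g (A (e i)) (A (e i)).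
    by rewrite -sumrN; apply: eq_bigr => i _; rewrite (lc_skew lc).
  have := eq_bigr (op := +%R) (idx := 0) (r := index_enum _) (P := xpredT) _ (fun i _ => k1 i).
  rewrite -mulr_sumr !big_split /= !sumrN => k1s.
  by rewrite -!addrA; lra.
rewrite lt_neqAle; apply/andP; split; last first.
  by rewrite ricE sumr_ge0 // => i _; rewrite addr_ge0 ?dot_ge0 // subr_ge0.
apply/negP => /eqP/esym; rewrite ricE => /eqP.
rewrite psumr_eq0 => [|i _]; last by rewrite addr_ge0 ?dot_ge0 // subr_ge0.
move=> /allP z.
have zi i : A (e i) = 0 /\ x * q (a (e i)) (a (e i)) = g (a (e i)) (a (e i)).
  have /= := z i (mem_index_enum _).
  rewrite paddr_eq0 ?dot_ge0 ?subr_ge0 // => /andP[/eqP h1 /eqP/subr0_eq ->].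
  split=> //; apply/eqP; apply/negPn/negP => /(dot_gt0 g).
  by rewrite h1 ltxx.
move: ku; rewrite (lftrace_onb eE) // big1 ?ltxx // => i _.
by have [h1 h2] := zi i; have := k2 i; rewrite h1 h2 dot0l; lra.
Qed.

(** P selects a basis of the subspace where an isometric involutive automorphism
    is 1, and w, w' lie in the subspace where it is -1; this is where the two
    vanishing hypotheses come from.  In the trace of v |-> D (D v w) w', a
    basis vector v outside P has D v w in the span of P, so that part of
    the trace can be rewritten as a sum over P as well, and only the operators
    D e_i with P i are left. *)
Lemma ricci_split (P : pred 'I_n) w w' :
    (forall i j, P i -> P j -> g (D (e i) w') (e j) = 0) ->
    (forall i j, ~~ P i -> ~~ P j -> g (D (e i) w) (e j) = 0) ->
  ricci br D w w' = - \sum_(i | P i)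
     (2%:R * g (D (e i) w) (D (e i) w') + g w' (br (e i) (D (e i) w))
       + g w (br (e i) (D (e i) w'))).
Proof.
move=> hp hm; rewrite (ricciE brC lc eE unimodular) (bigID P) /= opprD.
have -> : - \sum_(i | P i) g (D (D (e i) w) w') (e i) = - \sum_(i | P i)
    (g (D (e i) w) (D (e i) w') + g w' (br (e i) (D (e i) w))).
  rewrite -!sumrN; apply: eq_bigr => i _; rewrite (lc_skew lc) opprK.
  rewrite (lc_tor lc) [br (D _ _) _]brC dotDr dotNr.
  rewrite [g w' (D _ _)]dotC (lc_skew lc); ring.
have -> : - \sum_(i | ~~ P i) g (D (D (e i) w) w') (e i) = - \sum_(i | P i)
    (g (D (e i) w) (D (e i) w') + g w (br (e i) (D (e i) w'))).
  have -> : - \sum_(i | ~~ P i) g (D (D (e i) w) w') (e i) =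
     \sum_(i | ~~ P i) \sum_(j | P j) g (D (e j) w') (e i) * g w (D (e i) (e j)).
    rewrite -sumrN; apply: eq_bigr => i Pi; rewrite (lc_skew lc) opprK.
    rewrite {1}(eE (D (e i) w)) (bigID P) /= [X in _ + X]big1 ?addr0 => [|j Pj].
      rewrite lc_suml dot_sumr; apply: eq_bigr => j Pj.
      rewrite lcZl dotZr (lc_skew lc (e i)) [g w' _]dotC.
      by rewrite (lc_skew lc (e j) (e i)) [g (e i) (D _ w')]dotC mulrNN mulrC.
    by rewrite hm // scale0r.
  rewrite exchange_big /= -sumrN; apply: eq_bigr => j Pj.
  transitivity (\sum_i g (D (e j) w') (e i) * g w (D (e i) (e j))).
    rewrite [RHS](bigID P) /= [X in _ = X + _]big1 ?add0r // => i Pi.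
    by rewrite hp // mul0r.
  transitivity (g w (D (D (e j) w') (e j))).
    rewrite {2}(eE (D (e j) w')) lc_suml dot_sumr.
    by apply: eq_bigr => i _; rewrite lcZl dotZr.
  rewrite (lc_tor lc) [br (D _ _) _]brC dotDr dotNr.
  rewrite [g w (D _ _)]dotC (lc_skew lc) [g _ (D _ w)]dotC; ring.
rewrite -opprD -big_split; congr (- _); apply: eq_bigr => i _ /=; ring.
Qed.

End RicciFormulas.

(** * Principal bases of two planes *)

Section TwoByTwo.
Variable R : rcfType.

(** A unit vector (c, s) parallel to (x, y), which may be zero. *)
Lemma unit_along (x y : R) : exists c s : R, c ^+ 2 + s ^+ 2 = 1 /\ c * y = s * x.
Proof.
have [xy0|xy0] := eqVneq (x ^+ 2 + y ^+ 2) 0.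
  have x0 : x = 0 by apply/eqP; rewrite -sqrf_eq0; apply/eqP; nra.
  have y0 : y = 0 by apply/eqP; rewrite -sqrf_eq0; apply/eqP; nra.
  by exists 1, 0; rewrite x0 y0; split; ring.
have p : 0 < x ^+ 2 + y ^+ 2 by rewrite lt_def xy0 addr_ge0 ?sqr_ge0.
set m := Num.sqrt (x ^+ 2 + y ^+ 2).
have m2 : m ^+ 2 = x ^+ 2 + y ^+ 2 by rewrite sqr_sqrtr // ltW.
have m0 : m != 0 by rewrite gt_eqF // sqrtr_gt0.
exists (x / m), (y / m); split; last by ring.
by rewrite !expr_div_n -mulrDl -m2 divff // sqrf_eq0.
Qed.

(** A rotation that diagonalizes the symmetric matrix with rows (a, b), (b, d). *)
Lemma sym_rotation (a b d : R) :
  exists c s : R, c ^+ 2 + s ^+ 2 = 1 /\ (c ^+ 2 - s ^+ 2) * b + c * s * (d - a) = 0.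
Proof.
have [->|b0] := eqVneq b 0; first by exists 1, 0; split; ring.
pose w := Num.sqrt ((d - a) ^+ 2 + 4%:R * b ^+ 2).
have w2 : w ^+ 2 = (d - a) ^+ 2 + 4%:R * b ^+ 2.
  by rewrite sqr_sqrtr // addr_ge0 ?sqr_ge0 // mulr_ge0 ?sqr_ge0 // ler0n.
(* twice an eigenvector, for the eigenvalue (a + d + w) / 2 *)
have [c [s [cs e]]] := unit_along (2%:R * b) (d - a + w).
exists c, s; split=> //.
have b20 : (2%:R * b) ^+ 2 != 0 by rewrite sqrf_eq0 mulf_neq0 // pnatr_eq0.
apply: (mulfI b20); rewrite mulr0.
have e2 : s * (2%:R * b) = c * (d - a + w) by rewrite e.
transitivity (b * (c ^+ 2 * (2%:R * b) ^+ 2 - (s * (2%:R * b)) ^+ 2)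
  + c * (s * (2%:R * b)) * (2%:R * b) * (d - a)); first by ring.
rewrite e2.
transitivity (b * c ^+ 2 * (4%:R * b ^+ 2 + (d - a) ^+ 2 - w ^+ 2)); first by ring.
by rewrite w2; ring.
Qed.

(** The singular value decomposition of the matrix with rows (p, q), (r, t):
    rotating the columns by an eigenbasis of the Gram matrix makes them
    orthogonal, and then a rotation of the rows makes the matrix diagonal. *)
Lemma svd2 (p q r t : R) : exists c1 s1 c2 s2 : R,
  [/\ c1 ^+ 2 + s1 ^+ 2 = 1, c2 ^+ 2 + s2 ^+ 2 = 1,
      c1 * (- s2 * p + c2 * q) + s1 * (- s2 * r + c2 * t) = 0 &
      - s1 * (c2 * p + s2 * q) + c1 * (c2 * r + s2 * t) = 0].
Proof.
have [c2 [s2 [u2 e2]]] :=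
  sym_rotation (p ^+ 2 + r ^+ 2) (p * q + r * t) (q ^+ 2 + t ^+ 2).
pose m1x := c2 * p + s2 * q; pose m1y := c2 * r + s2 * t.
pose m2x := - s2 * p + c2 * q; pose m2y := - s2 * r + c2 * t.
have orth : m1x * m2x + m1y * m2y = 0 by rewrite -e2 /m1x /m1y /m2x /m2y; ring.
have [m0|m0] := eqVneq (m1x ^+ 2 + m1y ^+ 2) 0.
  have x0 : m1x = 0 by apply/eqP; rewrite -sqrf_eq0; apply/eqP; nra.
  have y0 : m1y = 0 by apply/eqP; rewrite -sqrf_eq0; apply/eqP; nra.
  (* the first column is zero: the row rotation has to follow the second *)
  have [c [s [u e]]] := unit_along (- m2y) m2x.
  exists c, s, c2, s2; rewrite -/m1x -/m1y -/m2x -/m2y x0 y0.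
  by split=> //; rewrite ?e; ring.
have [c [s [u e]]] := unit_along m1x m1y.
exists c, s, c2, s2; rewrite -/m1x -/m1y -/m2x -/m2y; split=> //; last first.
  by rewrite e; ring.
apply: (mulfI m0); rewrite mulr0.
transitivity ((c * m1x + s * m1y) * (m1x * m2x + m1y * m2y)
  + (c * m1y - s * m1x) * (m1y * m2x - m1x * m2y)); first by ring.
by rewrite orth e subrr mul0r mulr0 addr0.
Qed.

(** Cleared of denominators this says
      (h^2 + k^2) (x^2 + y^2 - 2 f^2) >= 2 h k f (1 - f^2),  f = x y.
    In the variables h + k and h - k the quadratic form is diagonal, and its
    coefficients x^2 + y^2 - 2 f^2 -+ f (1 - f^2) are nonnegative because
    x^2 + y^2 >= 2 |f| and |f| < 1. *)
Lemma odd_pair_le0 (x y h k : R) : 0 < 1 - x ^+ 2 -> 0 < 1 - y ^+ 2 ->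
  x * ((1 - x ^+ 2)^-2 * (- x * k ^+ 2
         + (1 - y ^+ 2)^-1 * ((h - y * x * k) * (- x * h + y * k))))
  + y * ((1 - y ^+ 2)^-2 * (- y * h ^+ 2
         + (1 - x ^+ 2)^-1 * ((k - x * y * h) * (- y * k + x * h)))) <= 0.
Proof.
move=> Dx Dy; set f := x * y.
have -> : x * ((1 - x ^+ 2)^-2 * (- x * k ^+ 2
         + (1 - y ^+ 2)^-1 * ((h - y * x * k) * (- x * h + y * k))))
  + y * ((1 - y ^+ 2)^-2 * (- y * h ^+ 2
         + (1 - x ^+ 2)^-1 * ((k - x * y * h) * (- y * k + x * h))))
  = - ((h ^+ 2 + k ^+ 2) * (x ^+ 2 + y ^+ 2 - 2%:R * f ^+ 2)
        - 2%:R * h * k * f * (1 - f ^+ 2))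
    / ((1 - x ^+ 2) * (1 - y ^+ 2)) ^+ 2.
  by rewrite /f; field; rewrite !gt_eqF.
rewrite mulNr oppr_le0 divr_ge0 ?sqr_ge0 //.
have f1 : f ^+ 2 < 1.
  have y1 : y ^+ 2 < 1 by rewrite -subr_gt0.
  rewrite /f exprMn mulrC; apply: le_lt_trans y1.
  by rewrite ler_piMr ?sqr_ge0 // -subr_ge0 ltW.
have /andP[f1' f1''] : -1 < f < 1.
  by rewrite -ltr_norml -(expr_lt1 (n := 2)) // real_normK // num_real.
have -> : (h ^+ 2 + k ^+ 2) * (x ^+ 2 + y ^+ 2 - 2%:R * f ^+ 2)
        - 2%:R * h * k * f * (1 - f ^+ 2)
  = 2%:R^-1 * ((h + k) ^+ 2 * (x ^+ 2 + y ^+ 2 - 2%:R * f ^+ 2 - f * (1 - f ^+ 2))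
   + (h - k) ^+ 2 * (x ^+ 2 + y ^+ 2 - 2%:R * f ^+ 2 + f * (1 - f ^+ 2))).
  by field.
have sxy : 2%:R * `|f| <= x ^+ 2 + y ^+ 2.
  rewrite /f; have [_|_] := ger0P (x * y).
    by have := sqr_ge0 (x - y); nra.
  by have := sqr_ge0 (x + y); nra.
clearbody f; rewrite mulr_ge0 ?invr_ge0 ?ler0n // addr_ge0 // mulr_ge0 ?sqr_ge0 //.
  have [f0|f0] := ger0P f; rewrite ?(ger0_norm f0) ?(ltr0_norm f0) in sxy.
    (* 2 f - 2 f^2 - f (1 - f^2) = f (1 - f)^2, and similarly below *)
    have : 0 <= f * (1 - f) ^+ 2 by rewrite mulr_ge0 // sqr_ge0.
    nra.
  have : 0 <= (- f) * (3%:R - f) * (1 + f).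
    by rewrite !mulr_ge0 //; lra.
  nra.
have [f0|f0] := ger0P f; rewrite ?(ger0_norm f0) ?(ltr0_norm f0) in sxy.
  have : 0 <= f * (3%:R + f) * (1 - f).
    by rewrite !mulr_ge0 //; lra.
  nra.
have : 0 <= (- f) * (1 + f) ^+ 2 by rewrite mulr_ge0 ?sqr_ge0 //; lra.
nra.
Qed.

End TwoByTwo.

Section Planes.
Variables (R : rcfType) (L : vectType R) (g : {dot L for idfun}).

(** Both changes of basis are recorded: vectors given in X, Y are rewritten in
    v1, v2, and what is proved for v1, v2 is carried back to X, Y. *)
Definition same_plane (X Y v1 v2 : L) : Prop :=
  exists a1 b1 a2 b2 p1 q1 p2 q2 : R,
  [/\ v1 = a1 *: X + b1 *: Y, v2 = a2 *: X + b2 *: Y,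
      X = p1 *: v1 + q1 *: v2 & Y = p2 *: v1 + q2 *: v2].

Lemma gram_schmidt2 X Y : X != 0 -> (forall t, Y != t *: X) ->
  exists U W, [/\ same_plane X Y U W, g U U = 1, g W W = 1 & g U W = 0].
Proof.
move=> X0 YX; have gX := dot_gt0 g X0.
pose m := Num.sqrt (g X X).
have m2 : m ^+ 2 = g X X by rewrite sqr_sqrtr // ltW.
have m0 : m != 0 by rewrite gt_eqF // sqrtr_gt0.
pose t := g Y X / g X X; pose Z := Y - t *: X.
have Z0 : Z != 0 by rewrite subr_eq0.
have gZ := dot_gt0 g Z0.
pose k := Num.sqrt (g Z Z).
have k2 : k ^+ 2 = g Z Z by rewrite sqr_sqrtr // ltW.
have k0 : k != 0 by rewrite gt_eqF // sqrtr_gt0.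
have gXZ : g X Z = 0.
  rewrite /Z !dotE (dotC g X Y) /t; field; exact: lt0r_neq0.
exists (m^-1 *: X), (k^-1 *: Z); split.
- exists m^-1, 0, (- (k^-1 * t)), k^-1, m, 0, (m * t), k; split.
  + by rewrite scale0r addr0.
  + by rewrite scalerBr scalerA addrC scaleNr.
  + by rewrite scale0r addr0 scalerA divff // scale1r.
  + rewrite !scalerA divff // scale1r mulrAC divff // mul1r.
    by rewrite addrC subrK.
- by rewrite dotZl dotZr -m2; field.
- by rewrite dotZl dotZr -k2; field.
- by rewrite dotZl dotZr gXZ !mulr0.
Qed.

Lemma same_plane_rot X Y U W c s : c ^+ 2 + s ^+ 2 = 1 -> same_plane X Y U W ->
  same_plane X Y (c *: U + s *: W) (- s *: U + c *: W).
Proof.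
move=> cs [a1 [b1 [a2 [b2 [p1 [q1 [p2 [q2 [UE WE XE YE]]]]]]]]].
exists (c * a1 + s * a2), (c * b1 + s * b2), (- s * a1 + c * a2),
  (- s * b1 + c * b2), (p1 * c + q1 * s), (- p1 * s + q1 * c),
  (p2 * c + q2 * s), (- p2 * s + q2 * c).
have back p q : p *: U + q *: W =
    (p * c + q * s) *: (c *: U + s *: W) + (- p * s + q * c) *: (- s *: U + c *: W).
  rewrite !scalerDr !scalerA addrACA -!scalerDl.
  congr (_ *: _ + _ *: _).
    by transitivity (p * (c ^+ 2 + s ^+ 2)); [rewrite cs mulr1 | ring].
  by transitivity (q * (c ^+ 2 + s ^+ 2)); [rewrite cs mulr1 | ring].
split; try by rewrite -back.
- by rewrite UE WE !scalerDr !scalerA addrACA -!scalerDl.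
- by rewrite UE WE !scalerDr !scalerA addrACA -!scalerDl.
Qed.

(** Principal vectors of two planes: g(v1, v1') and g(v2, v2') are the cosines
    of the principal angles.  They are less than 1 in absolute value because
    the planes meet only in 0. *)
Lemma principal_bases X Y X' Y' :
    X != 0 -> (forall t, Y != t *: X) -> X' != 0 -> (forall t, Y' != t *: X') ->
    (forall a b a' b', a *: X + b *: Y = a' *: X' + b' *: Y' ->
      a *: X + b *: Y = 0) ->
  exists v1 v2 v1' v2', [/\ same_plane X Y v1 v2, same_plane X' Y' v1' v2',
    [/\ g v1 v1 = 1, g v2 v2 = 1 & g v1 v2 = 0],
    [/\ g v1' v1' = 1, g v2' v2' = 1 & g v1' v2' = 0] &
    [/\ g v1 v2' = 0, g v2 v1' = 0, 0 < 1 - g v1 v1' ^+ 2 & 0 < 1 - g v2 v2' ^+ 2]].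
Proof.
move=> X0 YX X0' YX' dis.
have [U [W [pU U1 W1 UW]]] := gram_schmidt2 X0 YX.
have [U' [W' [pU' U1' W1' UW']]] := gram_schmidt2 X0' YX'.
have [c1 [s1 [c2 [s2 [cs1 cs2 h1 h2]]]]] := svd2 (g U U') (g U W') (g W U') (g W W').
have := same_plane_rot cs1 pU; have := same_plane_rot cs2 pU'.
set v1' := c2 *: U' + _; set v2' := - s2 *: U' + _.
set v1 := c1 *: U + _; set v2 := - s1 *: U + _ => pv' pv.
have n1 : g v1 v1 = 1.
  by rewrite /v1 !dotE (dotC g W U) U1 W1 UW; lra.
have n2 : g v2 v2 = 1.
  by rewrite /v2 !dotE (dotC g W U) U1 W1 UW; lra.
have n1' : g v1' v1' = 1.
  by rewrite /v1' !dotE (dotC g W' U') U1' W1' UW'; lra.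
have n2' : g v2' v2' = 1.
  by rewrite /v2' !dotE (dotC g W' U') U1' W1' UW'; lra.
have strict (v v' : L) : (exists a b, v = a *: X + b *: Y) ->
    (exists a b, v' = a *: X' + b *: Y') -> g v v = 1 -> g v' v' = 1 ->
    0 < 1 - g v v' ^+ 2.
  move=> [a [b vE]] [a' [b' vE']] nv nv'.
  have vv : v - g v v' *: v' != 0.
    rewrite subr_eq0; apply/eqP => e.
    have v0 : v = 0.
      rewrite vE; apply: (dis a b (g v v' * a') (g v v' * b')).
      by rewrite -vE {1}e vE' scalerDr !scalerA.
    by move: nv; rewrite v0 dot0l => /eqP; rewrite eq_sym oner_eq0.
  have := dot_gt0 g vv; rewrite !dotE nv nv' (dotC g v' v).
  by congr (0 < _); ring.
exists v1, v2, v1', v2'; split=> //.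
- by split=> //; rewrite /v1 /v2 !dotE (dotC g W U) U1 W1 UW; ring.
- by split=> //; rewrite /v1' /v2' !dotE (dotC g W' U') U1' W1' UW'; ring.
case: pv pv' => [a1 [b1 [a2 [b2 [? [? [? [? [e1 e2 _ _]]]]]]]]].
case=> [a1' [b1' [a2' [b2' [? [? [? [? [e1' e2' _ _]]]]]]]]].
split.
- by rewrite /v1 /v2' !dotE -[RHS]h1; ring.
- by rewrite /v2 /v1' !dotE -[RHS]h2; ring.
- by apply: strict => //; [exists a1, b1 | exists a1', b1'].
- by apply: strict => //; [exists a2, b2 | exists a2', b2'].
Qed.

End Planes.

Section PrincipalSum.
Variables (R : rcfType) (L : vectType R) (g : {dot L for idfun}).
Variables (T1 T2 v1 v2 v1' v2' : L).
Hypothesis dimL : \dim {:L} = 6%N.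
Hypothesis onT : [/\ g T1 T1 = 1, g T2 T2 = 1 & g T1 T2 = 0].
Hypothesis onv : [/\ g v1 v1 = 1, g v2 v2 = 1 & g v1 v2 = 0].
Hypothesis onv' : [/\ g v1' v1' = 1, g v2' v2' = 1 & g v1' v2' = 0].
Hypothesis cross : [/\ g v1 v2' = 0, g v2 v1' = 0, 0 < 1 - g v1 v1' ^+ 2 &
  0 < 1 - g v2 v2' ^+ 2].
Hypothesis Tv : [/\ g T1 v1 = 0, g T1 v2 = 0, g T1 v1' = 0 & g T1 v2' = 0].
Hypothesis Tv2 : [/\ g T2 v1 = 0, g T2 v2 = 0, g T2 v1' = 0 & g T2 v2' = 0].
Let x := g v1 v1'.
Let y := g v2 v2'.

(** Together these four vectors form the g-dual basis of v1, v2, v1', v2' in the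
    orthogonal of T1, T2; the inverted 2 x 2 Gram matrices have determinants
    1 - x^2 and 1 - y^2. *)
Definition dual1 := (1 - x ^+ 2)^-1 *: (v1 - x *: v1').
Definition dual2 := (1 - y ^+ 2)^-1 *: (v2 - y *: v2').
Definition dual1' := (1 - x ^+ 2)^-1 *: (v1' - x *: v1).
Definition dual2' := (1 - y ^+ 2)^-1 *: (v2' - y *: v2).

(** Gram-Schmidt applied to T1, T2, v1, v2, v1', v2'. *)
Definition adapted_basis (i : 'I_6) : L :=
  [:: T1; T2; v1; v2; (Num.sqrt (1 - x ^+ 2))^-1 *: (v1' - x *: v1);
      (Num.sqrt (1 - y ^+ 2))^-1 *: (v2' - y *: v2)]`_i.

Let Dx : 1 - x ^+ 2 != 0. Proof. by case: cross => _ _ /lt0r_neq0. Qed.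
Let Dy : 1 - y ^+ 2 != 0. Proof. by case: cross => _ _ _ /lt0r_neq0. Qed.

Lemma adapted_onb i j : g (adapted_basis i) (adapted_basis j) = (i == j)%:R.
Proof.
case: onT onv onv' cross Tv Tv2.
move=> h1 h2 h3 [h4 h5 h6] [h7 h8 h9] [h10 h11 px py] [t1 t2 t3 t4] [t5 t6 t7 t8].
have sx : (Num.sqrt (1 - x ^+ 2)) ^+ 2 = 1 - x ^+ 2 by rewrite sqr_sqrtr // ltW.
have sy : (Num.sqrt (1 - y ^+ 2)) ^+ 2 = 1 - y ^+ 2 by rewrite sqr_sqrtr // ltW.
have sx0 : Num.sqrt (1 - x ^+ 2) != 0 by rewrite gt_eqF // sqrtr_gt0.
have sy0 : Num.sqrt (1 - y ^+ 2) != 0 by rewrite gt_eqF // sqrtr_gt0.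
have sym (p q : 'I_6) : (p <= q)%N ->
    g (adapted_basis p) (adapted_basis q) = (p == q)%:R; last first.
  by case: (leqP i j) => [/sym//|/ltnW/sym]; rewrite dotC eq_sym.
rewrite /adapted_basis -(inj_eq val_inj).
have h6' : g v2 v1 = 0 by rewrite dotC.
have h9' : g v2' v1' = 0 by rewrite dotC.
have h10' : g v2' v1 = 0 by rewrite dotC.
have h11' : g v1' v2 = 0 by rewrite dotC.
have hx : g v1' v1 = x by rewrite dotC.
have hy : g v2' v2 = y by rewrite dotC.
case: p => [[|[|[|[|[|[|//]]]]]] ?]; case: q => [[|[|[|[|[|[|//]]]]]] ?] //= _;
  rewrite !(dotE, h1, h2, h3, h4, h5, h6, h7, h8, h9, h10, h11, t1, t2, t3, t4)
    ?(t5, t6, t7, t8, h6', h9', h10', h11', hx, hy) -?/x -?/y; try ring.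
- transitivity ((1 - x ^+ 2) / Num.sqrt (1 - x ^+ 2) ^+ 2); first by field.
  by rewrite sx divff.
- transitivity ((1 - y ^+ 2) / Num.sqrt (1 - y ^+ 2) ^+ 2); first by field.
  by rewrite sy divff.
Qed.

Lemma adapted_expand v : v = \sum_i g v (adapted_basis i) *: adapted_basis i.
Proof. by apply: onb_expand adapted_onb v; rewrite dimL. Qed.

Lemma dual_expand v : g v T1 = 0 -> g v T2 = 0 ->
  v = g v v1 *: dual1 + g v v2 *: dual2 + g v v1' *: dual1' + g v v2' *: dual2'.
Proof.
move=> vT1 vT2; set w := RHS.
case: onT onv onv' cross Tv Tv2.
move=> h1 h2 h3 [h4 h5 h6] [h7 h8 h9] [h10 h11 px py] [t1 t2 t3 t4] [t5 t6 t7 t8].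
have h6' : g v2 v1 = 0 by rewrite dotC.
have h9' : g v2' v1' = 0 by rewrite dotC.
have h10' : g v2' v1 = 0 by rewrite dotC.
have h11' : g v1' v2 = 0 by rewrite dotC.
have hx : g v1' v1 = x by rewrite dotC.
have hy : g v2' v2 = y by rewrite dotC.
have s1 : g v1 T1 = 0 by rewrite dotC.
have s2 : g v2 T1 = 0 by rewrite dotC.
have s3 : g v1' T1 = 0 by rewrite dotC.
have s4 : g v2' T1 = 0 by rewrite dotC.
have s5 : g v1 T2 = 0 by rewrite dotC.
have s6 : g v2 T2 = 0 by rewrite dotC.
have s7 : g v1' T2 = 0 by rewrite dotC.
have s8 : g v2' T2 = 0 by rewrite dotC.
have eqT1 : g w T1 = 0 by rewrite /w /dual1 /dual2 /dual1' /dual2' !dotE s1 s2 s3 s4; ring.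
have eqT2 : g w T2 = 0 by rewrite /w /dual1 /dual2 /dual1' /dual2' !dotE s5 s6 s7 s8; ring.
have eq1 : g w v1 = g v v1.
  rewrite /w /dual1 /dual2 /dual1' /dual2' !dotE h4 h6' hx h10' -/x -/y.
  by field; do ?[apply/andP; split].
have eq2 : g w v2 = g v v2.
  rewrite /w /dual1 /dual2 /dual1' /dual2' !dotE h6 h5 h11' hy -/x -/y.
  by field; do ?[apply/andP; split].
have eq1' : g w v1' = g v v1'.
  rewrite /w /dual1 /dual2 /dual1' /dual2' !dotE h11 h7 h9' -/x -/y.
  by field; do ?[apply/andP; split].
have eq2' : g w v2' = g v v2'.
  rewrite /w /dual1 /dual2 /dual1' /dual2' !dotE h10 h9 h8 -/x -/y.
  by field; do ?[apply/andP; split].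
clearbody w; rewrite [LHS]adapted_expand [RHS]adapted_expand; apply: eq_bigr => i _; congr (_ *: _).
rewrite /adapted_basis; case: i => [[|[|[|[|[|[|//]]]]]] ?] /=;
  by rewrite ?dotE ?vT1 ?vT2 ?eqT1 ?eqT2 ?eq1 ?eq2 ?eq1' ?eq2'.
Qed.

(** The skew operator A enters through the numbers g(A v_a, v_b') alone.
    The two diagonal ones contribute - x^2 h11^2 / (1 - x^2)^2 and
    - y^2 h22^2 / (1 - y^2)^2, and the two others, h12 and h21, give the
    expression of [odd_pair_le0]. *)
Lemma principal_sum_le0 (A : L -> L) :
    linear A -> (forall X Y, g (A X) Y = - g X (A Y)) ->
    g (A v1) v2 = 0 -> g (A v1') v2' = 0 ->
    (forall X, X \in [:: v1; v2; v1'; v2'] -> g (A X) T1 = 0 /\ g (A X) T2 = 0) ->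
  x * g (A dual1) (A dual1') + y * g (A dual2) (A dual2') <= 0.
Proof.
move=> Al sk k12 k12' kT.
have [_ _ px py] := cross.
have sx : (Num.sqrt (1 - x ^+ 2)) ^+ 2 = 1 - x ^+ 2 by rewrite sqr_sqrtr // ltW.
have sy : (Num.sqrt (1 - y ^+ 2)) ^+ 2 = 1 - y ^+ 2 by rewrite sqr_sqrtr // ltW.
have sx0 : Num.sqrt (1 - x ^+ 2) != 0 by rewrite gt_eqF // sqrtr_gt0.
have sy0 : Num.sqrt (1 - y ^+ 2) != 0 by rewrite gt_eqF // sqrtr_gt0.
have kT1 X : X \in [:: v1; v2; v1'; v2'] -> g (A X) T1 = 0 by case/kT.
have kT2 X : X \in [:: v1; v2; v1'; v2'] -> g (A X) T2 = 0 by case/kT.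
have A0 X : g (A X) X = 0.
  by have := sk X X; rewrite (dotC g X); lra.
have AC X Y : g (A X) Y = - g (A Y) X by rewrite sk dotC.
have AB a b X Y : A (a *: (X - b *: Y)) = a *: (A X - b *: A Y).
  have AZ c Z : A (c *: Z) = c *: A Z.
    by rewrite -[_ *: Z]addr0 Al linear_at0 // addr0.
  by rewrite AZ -scaleNr addrC Al scaleNr addrC.
pose h11 := g (A v1) v1'; pose h12 := g (A v1) v2'.
pose h21 := g (A v2) v1'; pose h22 := g (A v2) v2'.
have mem : [/\ v1 \in [:: v1; v2; v1'; v2'], v2 \in [:: v1; v2; v1'; v2'],
  v1' \in [:: v1; v2; v1'; v2'] & v2' \in [:: v1; v2; v1'; v2']].
  by rewrite !inE !eqxx !orbT.
have [m1 m2 m3 m4] := mem.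
have E1 : g (A dual1) (A dual1') = - x * h11 ^+ 2 * (1 - x ^+ 2)^-2
  + (1 - x ^+ 2)^-2 * (- x * h21 ^+ 2
         + (1 - y ^+ 2)^-1 * ((h12 - y * x * h21) * (- x * h12 + y * h21))).
  rewrite /dual1 /dual1' !AB (parseval adapted_expand) /adapted_basis.
  rewrite !big_ord_recr big_ord0 /= !dotE !(kT1, kT2) // !(A0, k12, k12').
  rewrite (AC v1' v1) (AC v1' v2) -/h11 -/h12 -/h21.
  transitivity (- x * h11 ^+ 2 * (1 - x ^+ 2)^-2
   + (1 - x ^+ 2)^-2 * (- x * h21 ^+ 2
    + (Num.sqrt (1 - y ^+ 2) ^+ 2)^-1 * ((h12 - y * x * h21) * (- x * h12 + y * h21)))).
    by field; apply/and3P; split.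
  by rewrite sy.
have E2 : g (A dual2) (A dual2') = - y * h22 ^+ 2 * (1 - y ^+ 2)^-2
  + (1 - y ^+ 2)^-2 * (- y * h12 ^+ 2
         + (1 - x ^+ 2)^-1 * ((h21 - x * y * h12) * (- y * h21 + x * h12))).
  rewrite /dual2 /dual2' !AB (parseval adapted_expand) /adapted_basis.
  rewrite !big_ord_recr big_ord0 /= !dotE !(kT1, kT2) // !A0.
  rewrite (AC v2' v1) (AC v2' v2) (AC v2' v1') (AC v2 v1) k12 k12' -/h21 -/h12 -/h22.
  transitivity (- y * h22 ^+ 2 * (1 - y ^+ 2)^-2
   + (1 - y ^+ 2)^-2 * (- y * h12 ^+ 2
    + (Num.sqrt (1 - x ^+ 2) ^+ 2)^-1 * ((h21 - x * y * h12) * (- y * h21 + x * h12)))).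
    by field; apply/and3P; split.
  by rewrite sx.
rewrite E1 E2.
have := odd_pair_le0 h12 h21 px py; rewrite -/x -/y => le.
have q1 : 0 <= x ^+ 2 * h11 ^+ 2 * (1 - x ^+ 2)^-2.
  by apply: mulr_ge0; rewrite ?invr_ge0 ?sqr_ge0 //; apply: mulr_ge0; exact: sqr_ge0.
have q2 : 0 <= y ^+ 2 * h22 ^+ 2 * (1 - y ^+ 2)^-2.
  by apply: mulr_ge0; rewrite ?invr_ge0 ?sqr_ge0 //; apply: mulr_ge0; exact: sqr_ge0.
apply: le_trans (_ : - (x ^+ 2 * h11 ^+ 2 * (1 - x ^+ 2)^-2)
  - (y ^+ 2 * h22 ^+ 2 * (1 - y ^+ 2)^-2) + 0 <= 0); last by lra.
apply: le_trans (lerD (lexx _) le); rewrite le_eqVlt; apply/orP; left.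
by apply/eqP; ring.
Qed.

End PrincipalSum.

(** * The largest eigenvector of an inner product *)

Section MaxRatio.
Variables (R : realType) (L : vectType R) (g : {dot L for idfun}).

(** A maximum v of g on the unit sphere of q.  The nonnegative form x q - g
    vanishes at v, hence v is in its radical, which says that v is an
    eigenvector. *)
Lemma max_eigenvector n (u : 'I_n.+1 -> L) (c : 'I_n.+1 -> L -> R)
    (q := fun v w => \sum_i c i v * c i w) :
    (forall i, scalar (c i)) -> (forall v, v = \sum_i c i v *: u i) ->
    (forall i j, c i (u j) = (i == j)%:R) ->
  exists x v, [/\ v != 0, forall w, g w w <= x * q w w &
                  forall w, g v w = x * q v w].
Proof.
move=> cl uE cu.
have cD i v w : c i (v + w) = c i v + c i w.
  by rewrite -[v]scale1r cl mul1r scale1r.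
have c0 i : c i 0 = 0 by exact: scalar_at0.
have cZ i a v : c i (a *: v) = a * c i v by rewrite -[_ *: _]addr0 cl c0 addr0.
have cS i (a : 'rV[R]_n.+1) : c i (\sum_j a 0 j *: u j) = a 0 i.
  rewrite (big_morph (c i) (cD i) (c0 i)) (bigD1 i) //= cZ cu eqxx mulr1.
  by rewrite big1 ?addr0 // => j /negPf ji; rewrite cZ cu eq_sym ji mulr0.
pose N (a : 'rV[R]_n.+1) := \sum_i a 0 i * a 0 i.
pose f (a : 'rV[R]_n.+1) := \sum_i \sum_j a 0 i * a 0 j * g (u i) (u j).
have fE a : f a = g (\sum_i a 0 i *: u i) (\sum_i a 0 i *: u i).
  rewrite dot_suml; apply: eq_bigr => i _; rewrite dot_sumr.
  by apply: eq_bigr => j _; rewrite dotZl dotZr mulrA.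
have contP (i j : 'I_n.+1) : continuous (fun a : 'rV[R]_n.+1 => a 0 i * a 0 j).
  by move=> a; apply: continuousM; exact: coord_continuous.
have contS (F : 'I_n.+1 -> 'rV[R]_n.+1 -> R) :
    (forall i, continuous (F i)) -> continuous (fun a => \sum_i F i a).
  by move=> h; apply: continuous_big => // x; exact: add_continuous.
have contN : continuous N by apply: contS => i; exact: contP.
have contf : continuous f.
  apply: (contS) => i; apply: (contS) => j a.
  apply: (@continuousM R 'rV[R]_n.+1 (fun b : 'rV[R]_n.+1 => b 0 i * b 0 j)
    (fun=> g (u i) (u j)) a); [exact: contP | exact: cst_continuous].
pose A : set 'rV[R]_n.+1 := [set a | N a = 1].
(* the sphere is closed in the compact cube with sides [-1, 1] *)
have cA : compact A.
  have K := @rV_compact R n.+1 (fun=> `[-1, 1]%classic) (fun _ => @segment_compact R (-1) 1).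
  apply: (subclosed_compact _ K).
    by have /continuous_closedP/(_ [set x | x = 1]) := contN; apply; exact: closed_eq.
  move=> a /= Na i; rewrite /= in_itv /= -ler_norml -(expr_le1 (n := 2)) //.
  rewrite real_normK ?num_real // -Na /N (bigD1 i) //= expr2 lerDl sumr_ge0 // => j _.
  by rewrite -expr2 sqr_ge0.
have A0 : A !=set0.
  exists (delta_mx 0 0); rewrite /A /= /N (bigD1 0) //= !mxE eqxx mulr1 big1 ?addr0 //.
  by move=> i /negPf i0; rewrite !mxE i0 andbF mulr0.
have [a] := EVT_max_rV A0 cA (continuous_subspaceT contf).
rewrite inE => Na amax.
pose v := \sum_i a 0 i *: u i.
pose C w z := f a * q w z - g w z.
have qE w : q w w = N (\row_i c i w) by apply: eq_bigr => i _; rewrite mxE.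
have gE w : g w w = f (\row_i c i w).
  rewrite fE {1 2}(uE w).
  by congr (g _ _); apply: eq_bigr => i _; rewrite mxE.
have le1 w : g w w <= f a * q w w.
  have [->|w0] := eqVneq w 0.
    by rewrite dot0l /q big1 ?mulr0 // => i _; rewrite c0 mul0r.
  have q0 : 0 < q w w.
    rewrite lt_def sumr_ge0 ?andbT => [|i _]; last by rewrite -expr2 sqr_ge0.
    apply: contra w0; rewrite psumr_eq0 => [/allP h|i _]; last first.
      by rewrite -expr2 sqr_ge0.
    rewrite (uE w) big1 // => i _; have := h i (mem_index_enum _).
    by rewrite /= -expr2 sqrf_eq0 => /eqP ->; rewrite scale0r.
  pose s := (Num.sqrt (q w w))^-1.
  have s2 : s ^+ 2 = (q w w)^-1 by rewrite exprVn sqr_sqrtr // ltW.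
  have := amax (\row_i c i (s *: w)); rewrite inE /A /= -qE -gE dotZl dotZr.
  have -> : q (s *: w) (s *: w) = s ^+ 2 * q w w.
    rewrite /q mulr_sumr; apply: eq_bigr => i _; rewrite !cZ; ring.
  rewrite s2 mulVf ?gt_eqF // => /(_ erefl).
  by rewrite mulrA -expr2 s2 mulrC ler_pdivrMr.
have vE : v = \sum_i (\row_i c i v) 0 i *: u i.
  by rewrite {1}(uE v); apply: eq_bigr => i _; rewrite mxE.
have rv : \row_i c i v = a by apply/rowP => i; rewrite mxE /v cS.
have Cv : g v v = f a * q v v by rewrite gE qE rv Na mulr1.
exists (f a), v; split=> // [|w].
  apply: contra_eq_neq Na => v0; rewrite -rv v0 /N big1 ?(eq_sym 0) ?oner_neq0 //.
  by move=> i _; rewrite mxE c0 mul0r.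
(* C >= 0 and C v v = 0 imply C v w = 0: discriminant of C (v + t w) *)
have qD1 w1 w2 z : q (w1 + w2) z = q w1 z + q w2 z.
  by rewrite /q -big_split; apply: eq_bigr => i _; rewrite cD mulrDl.
have qZ1 t w1 z : q (t *: w1) z = t * q w1 z.
  by rewrite /q mulr_sumr; apply: eq_bigr => i _; rewrite cZ mulrA.
have qC w1 z : q w1 z = q z w1 by apply: eq_bigr => i _; rewrite mulrC.
have key t : 0 <= 2%:R * t * C v w + t ^+ 2 * C w w.
  have := le1 (v + t *: w).
  rewrite !qD1 ![q _ (v + _)]qC !qD1 !qZ1 ![q _ (t *: w)]qC !qZ1 !dotE.
  rewrite (dotC g w v) (qC w v) Cv /C -subr_ge0 => h; apply: le_trans h _.
  by rewrite le_eqVlt; apply/orP; left; apply/eqP; ring.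
have Cw : 0 <= C w w by rewrite /C subr_ge0.
suff : C v w = 0 by move/eqP; rewrite /C subr_eq0 => /eqP.
have [Cw0|Cw0] := eqVneq (C w w) 0.
  by have := key 1; have := key (-1); rewrite Cw0; lra.
have Cp : 0 < C w w by rewrite lt_def Cw0.
have := key (- C v w / C w w).
have -> : 2%:R * (- C v w / C w w) * C v w + (- C v w / C w w) ^+ 2 * C w w
   = - (C v w ^+ 2 / C w w) by field.
rewrite oppr_ge0 => h; apply/eqP; rewrite -sqrf_eq0 eq_le sqr_ge0 andbT.
by rewrite -(pmulr_lle0 _ (_ : 0 < (C w w)^-1)) ?invr_gt0 // mulrC.
Qed.

End MaxRatio.

(** * su(2) as the imaginary quaternions *)

Section Su2.
Variable R : rcfType.
Local Notation su2 := (su2 R).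
Local Notation SU2 := (SU2 R).
Implicit Types X Y Z : su2.

(** The coordinates are those along the imaginary quaternions i, j, k; in them
    the bracket is twice the cross product. *)
Definition su2_mk (x y z : R) : su2 :=
  MkSu2 (mx_of_coord_su2 (\row_j [:: x; y; z]`_j)).

Lemma su2_mkP X : exists x y z, X = su2_mk x y z.
Proof.
exists (su2_coord X 0 0), (su2_coord X 0 1), (su2_coord X 0 2%:R).
rewrite -[LHS]mx_of_coordK; apply: val_inj; rewrite /su2_mk /=; congr mx_of_coord.
by apply/rowP => -[[|[|[|//]]] ?]; rewrite !mxE.
Qed.

Definition su2_dot X Y : R := \sum_j su2_coord X 0 j * su2_coord Y 0 j.

Lemma su2_dot_mk x y z x' y' z' :
  su2_dot (su2_mk x y z) (su2_mk x' y' z') = x * x' + y * y' + z * z'.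
Proof.
by rewrite /su2_dot /su2_mk !su2_coordK !big_ord_recr big_ord0 /= !mxE /= add0r.
Qed.

Lemma mx2_eq (A B : 'M[R[i]]_2) :
  A 0 0 = B 0 0 -> A 0 1 = B 0 1 -> A 1 0 = B 1 0 -> A 1 1 = B 1 1 -> A = B.
Proof.
move=> h1 h2 h3 h4; apply/matrixP.
have two (i : 'I_2) : i = 0 \/ i = 1.
  by case: i => [[|[|//]] ?]; [left|right]; apply: val_inj.
by move=> i j; case: (two i) (two j) => -> [] ->.
Qed.

Lemma mulmx2 (A B : 'M[R[i]]_2) i j :
  (A *m B) i j = A i 0 * B 0 j + A i 1 * B 1 j.
Proof.
rewrite mxE !big_ord_recl big_ord0 addr0.
by congr (_ + A _ _ * B _ _); apply: val_inj.
Qed.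

Lemma su2_mkD x y z x' y' z' :
  su2_mk x y z + su2_mk x' y' z' = su2_mk (x + x') (y + y') (z + z').
Proof.
apply: val_inj => /=; apply/matrixP => i j; rewrite !mxE /=.
by case: ifP => _; case: ifP => _; apply/eqP; rewrite eq_complex /= ?addr0 ?opprD !eqxx.
Qed.

Lemma su2_mkZ a x y z : a *: su2_mk x y z = su2_mk (a * x) (a * y) (a * z).
Proof.
apply: val_inj => /=; apply/matrixP => i j; rewrite !mxE /=.
by case: ifP => _; case: ifP => _; apply/eqP; rewrite eq_complex /=;
  apply/andP; split; apply/eqP; ring.
Qed.

Lemma su2_lie_mk x y z x' y' z' :
  su2_lie (su2_mk x y z) (su2_mk x' y' z') =
  su2_mk (2%:R * (y * z' - z * y')) (2%:R * (z * x' - x * z')) (2%:R * (x * y' - y * x')).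
Proof.
apply: val_inj; apply: mx2_eq; rewrite /su2_lie /= [LHS]mxE [X in _ + X]mxE !mulmx2 !mxE /=;
by apply/eqP; rewrite eq_complex /=; apply/andP; split; apply/eqP; ring.
Qed.

Lemma su2_lieC X Y : su2_lie Y X = - su2_lie X Y.
Proof. by apply: val_inj; rewrite /= opprB. Qed.

Lemma su2_lie0r X : su2_lie X 0 = 0.
Proof. by apply: val_inj; rewrite /= mul0mx mulmx0 subrr. Qed.

Lemma su2_lie0l X : su2_lie 0 X = 0.
Proof. by rewrite su2_lieC su2_lie0r oppr0. Qed.

Lemma su2_liexx X : su2_lie X X = 0.
Proof. by apply: val_inj; rewrite /= subrr. Qed.

Lemma su2_lieZl a X Y : su2_lie (a *: X) Y = a *: su2_lie X Y.
Proof. by rewrite -[a *: X]addr0 su2_lie_linearl su2_lie0l addr0. Qed.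

Lemma su2_lieDr a b X Y Z :
  su2_lie X (a *: Y + b *: Z) = a *: su2_lie X Y + b *: su2_lie X Z.
Proof.
by rewrite su2_lie_linearr -[b *: Z]addr0 su2_lie_linearr su2_lie0r !addr0.
Qed.

Lemma su2_lieDl a b X Y Z :
  su2_lie (a *: Y + b *: Z) X = a *: su2_lie Y X + b *: su2_lie Z X.
Proof. by rewrite su2_lieC su2_lieDr opprD -!scalerN -!su2_lieC. Qed.

Lemma su2_dotC X Y : su2_dot X Y = su2_dot Y X.
Proof. by apply: eq_bigr => i _; rewrite mulrC. Qed.

Lemma su2_dotDl X Y Z : su2_dot (X + Y) Z = su2_dot X Z + su2_dot Y Z.
Proof.
have [x [y [z ->]]] := su2_mkP X; have [x' [y' [z' ->]]] := su2_mkP Y.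
have [x2 [y2 [z2 ->]]] := su2_mkP Z; rewrite su2_mkD !su2_dot_mk; ring.
Qed.

Lemma su2_dotZl a X Z : su2_dot (a *: X) Z = a * su2_dot X Z.
Proof.
have [x [y [z ->]]] := su2_mkP X; have [x2 [y2 [z2 ->]]] := su2_mkP Z.
rewrite su2_mkZ !su2_dot_mk; ring.
Qed.

Lemma su2_dotNl X Z : su2_dot (- X) Z = - su2_dot X Z.
Proof. by rewrite -[X in - X]scale1r -scaleNr su2_dotZl mulN1r. Qed.

Lemma su2_dot_ad X Y Z : su2_dot (su2_lie X Y) Z = - su2_dot Y (su2_lie X Z).
Proof.
have [x [y [z ->]]] := su2_mkP X; have [x' [y' [z' ->]]] := su2_mkP Y.
have [x2 [y2 [z2 ->]]] := su2_mkP Z; rewrite !su2_lie_mk !su2_dot_mk; ring.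
Qed.

Lemma su2_dot_ge0 X : 0 <= su2_dot X X.
Proof. by apply: sumr_ge0 => i _; rewrite -expr2 sqr_ge0. Qed.

Lemma su2_dot0l X : su2_dot 0 X = 0.
Proof. by rewrite -(scale0r 0) su2_dotZl mul0r. Qed.
Lemma su2_dot0r X : su2_dot X 0 = 0.
Proof. by rewrite su2_dotC su2_dot0l. Qed.

Lemma su2_dot_eq0 X : su2_dot X X = 0 -> X = 0.
Proof.
have [x [y [z ->]]] := su2_mkP X; rewrite su2_dot_mk => h.
have x0 : x = 0 by apply/eqP; rewrite -sqrf_eq0; apply/eqP; nra.
have y0 : y = 0 by apply/eqP; rewrite -sqrf_eq0; apply/eqP; nra.
have z0 : z = 0 by apply/eqP; rewrite -sqrf_eq0; apply/eqP; nra.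
by rewrite x0 y0 z0 -(scale0r (su2_mk 1 1 1)) su2_mkZ !mul0r.
Qed.

(** Positively oriented orthonormal frames: they multiply like i, j, k. *)
Definition qframe (e1 e2 e3 : su2) : Prop :=
  [/\ [/\ su2_dot e1 e1 = 1, su2_dot e2 e2 = 1 & su2_dot e3 e3 = 1],
      [/\ su2_dot e1 e2 = 0, su2_dot e1 e3 = 0 & su2_dot e2 e3 = 0] &
      [/\ su2_lie e1 e2 = 2%:R *: e3, su2_lie e2 e3 = 2%:R *: e1 &
          su2_lie e3 e1 = 2%:R *: e2]].

(** The coordinate matrix M satisfies M M^T = 1, hence also M^T M = 1, and the
    rows of M expand every vector. *)
Lemma qframe_expand e1 e2 e3 X : qframe e1 e2 e3 ->
  X = su2_dot X e1 *: e1 + su2_dot X e2 *: e2 + su2_dot X e3 *: e3.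
Proof.
move=> [[h11 h22 h33] [h12 h13 h23] _].
pose M := \matrix_(i < 3) [:: su2_coord e1; su2_coord e2; su2_coord e3]`_i.
have dE U V : (su2_coord U *m (su2_coord V)^T) 0 0 = su2_dot U V.
  by rewrite mxE; apply: eq_bigr => j _; rewrite [X in _ * X]mxE.
have M1 : M *m M^T = 1%:M.
  apply/matrixP => i j.
  have -> : (M *m M^T) i j = (row i M *m (row j M)^T) 0 0.
    by rewrite !mxE; apply: eq_bigr => k _; rewrite !mxE.
  rewrite !rowK [RHS]mxE.
  case: i => [[|[|[|//]]] ?]; case: j => [[|[|[|//]]] ?] /=;
    by rewrite dE ?h11 ?h22 ?h33 ?h12 ?h13 ?h23 // su2_dotC.
have eqc : injective (@su2_coord R) := can_inj (@mx_of_coordK R).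
apply: eqc.
have lD U V : su2_coord (U + V) = su2_coord U + su2_coord V.
  by rewrite -[U]scale1r su2_coord_linear !scale1r.
have lZ a U : su2_coord (a *: U) = a *: su2_coord U.
  by apply: (addIr (su2_coord U)); rewrite -lD su2_coord_linear.
rewrite !lD !lZ -[LHS]mulmx1 -(mulmx1C M1) mulmxA.
rewrite (mulmx_sum_row (su2_coord X *m M^T) M) !big_ord_recr big_ord0 /= add0r.
have MX i : (su2_coord X *m M^T) 0 i = (su2_coord X *m (row i M)^T) 0 0.
  by rewrite !mxE; apply: eq_bigr => k _; rewrite !mxE.
by rewrite !MX !rowK /= !dE.
Qed.

(** Any unit vector orthogonal to e1 serves as e2, and then e3 is the cross
    product; the bracket relations are Lagrange's identities. *)
Lemma qframe_exists e1 : su2_dot e1 e1 = 1 -> exists e2 e3, qframe e1 e2 e3.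
Proof.
have [x [y [z ->]]] := su2_mkP e1; rewrite su2_dot_mk => u.
have [w [w1 w2]] : exists w, su2_dot w w = 1 /\ su2_dot (su2_mk x y z) w = 0.
  have [xy0|xy0] := eqVneq (x ^+ 2 + y ^+ 2) 0.
    have x0 : x = 0 by apply/eqP; rewrite -sqrf_eq0; apply/eqP; nra.
    exists (su2_mk 1 0 0); rewrite !su2_dot_mk x0; split; ring.
  have p : 0 < x ^+ 2 + y ^+ 2 by rewrite lt_def xy0 addr_ge0 ?sqr_ge0.
  pose m := Num.sqrt (x ^+ 2 + y ^+ 2).
  have m2 : m ^+ 2 = x ^+ 2 + y ^+ 2 by rewrite sqr_sqrtr // ltW.
  have m0 : m != 0 by rewrite gt_eqF // sqrtr_gt0.
  exists (su2_mk (- y / m) (x / m) 0); rewrite !su2_dot_mk; split; last by ring.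
  transitivity ((x ^+ 2 + y ^+ 2) / m ^+ 2); first by field.
  by rewrite -m2 divff // sqrf_eq0.
have [a [b [c wE]]] := su2_mkP w; rewrite wE !su2_dot_mk in w1 w2.
exists w, (su2_mk (y * c - z * b) (z * a - x * c) (x * b - y * a)).
rewrite /qframe wE !su2_dot_mk !su2_lie_mk !su2_mkZ.
have N : (y * c - z * b) * (y * c - z * b) + (z * a - x * c) * (z * a - x * c) +
   (x * b - y * a) * (x * b - y * a) = 1.
  transitivity ((x * x + y * y + z * z) * (a * a + b * b + c * c)
    - (x * a + y * b + z * c) ^+ 2); first by ring.
  by rewrite u w1 w2; ring.
split; split=> //; try by ring.
  congr su2_mk; congr (_ * _).
  - transitivity (x * (a * a + b * b + c * c) - a * (x * a + y * b + z * c)); first by ring.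
    by rewrite w1 w2; ring.
  - transitivity (y * (a * a + b * b + c * c) - b * (x * a + y * b + z * c)); first by ring.
    by rewrite w1 w2; ring.
  - transitivity (z * (a * a + b * b + c * c) - c * (x * a + y * b + z * c)); first by ring.
    by rewrite w1 w2; ring.
congr su2_mk; congr (_ * _).
- transitivity (a * (x * x + y * y + z * z) - x * (x * a + y * b + z * c)); first by ring.
  by rewrite u w2; ring.
- transitivity (b * (x * x + y * y + z * z) - y * (x * a + y * b + z * c)); first by ring.
  by rewrite u w2; ring.
- transitivity (c * (x * x + y * y + z * z) - z * (x * a + y * b + z * c)); first by ring.
  by rewrite u w2; ring.
Qed.

Lemma qframe_rot (e1 e2 e3 : su2) c s : c ^+ 2 + s ^+ 2 = 1 ->
  qframe e1 e2 e3 -> qframe e1 (c *: e2 + s *: e3) (- s *: e2 + c *: e3).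
Proof.
move=> cs [[a11 a22 a33] [a12 a13 a23] [l1 l2 l3]].
have dr a b (X Y Z : su2) : su2_dot X (a *: Y + b *: Z) = a * su2_dot X Y + b * su2_dot X Z.
  by rewrite su2_dotC su2_dotDl !su2_dotZl !(su2_dotC X).
have dl a b (X Y Z : su2) : su2_dot (a *: Y + b *: Z) X = a * su2_dot Y X + b * su2_dot Z X.
  by rewrite su2_dotDl !su2_dotZl.
have a32 : su2_dot e3 e2 = 0 by rewrite su2_dotC.
have l1' : su2_lie e2 e1 = - (2%:R *: e3) by rewrite su2_lieC l1.
have l2' : su2_lie e3 e2 = - (2%:R *: e1) by rewrite su2_lieC l2.
have l3' : su2_lie e1 e3 = - (2%:R *: e2) by rewrite su2_lieC l3.
split.
- by split; rewrite ?(dr, dl) ?a11 ?a22 ?a33 ?a12 ?a13 ?a23 ?a32; lra.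
- by split; rewrite ?(dr, dl) ?a11 ?a22 ?a33 ?a12 ?a13 ?a23 ?a32; lra.
split.
- rewrite su2_lieDr l1 l3' scalerN !scalerDr !scalerA -scaleNr addrC.
  by congr (_ *: _ + _ *: _); ring.
- rewrite su2_lieDr !su2_lieDl !su2_liexx l2 l2' !scaler0 add0r addr0 !scalerN !scalerA -scaleNr -scalerDl.
  congr (_ *: _); transitivity (2%:R * (c ^+ 2 + s ^+ 2)); first by ring.
  by rewrite cs mulr1.
rewrite su2_lieDl l3 l1' scalerN !scalerDr !scalerA -scaleNr addrC.
by congr (_ *: _ + _ *: _); ring.
Qed.

End Su2.

Section Ad2.
Variable R : rcfType.
Local Notation su2 := (su2 R).
Local Notation SU2 := (SU2 R).
Implicit Types X Y Z : su2.

Lemma det_mx2 (A : 'M[R[i]]_2) : \det A = A 0 0 * A 1 1 - A 0 1 * A 1 0.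
Proof.
rewrite (expand_det_row A 0) !big_ord_recl big_ord0 addr0 /cofactor /=.
rewrite !addn0 !add0n expr0 expr1 mul1r mulN1r mulrN.
rewrite ![\det _](@det_mx11) !mxE /=.
by congr (_ * A _ _ - A _ _ * A _ _); apply: val_inj.
Qed.

Lemma SU2_unit_subproof (e : su2) : su2_dot e e = 1 -> su2val e \in @SU2_pred R.
Proof.
have [x [y [z ->]]] := su2_mkP e; rewrite su2_dot_mk => u.
rewrite inE; apply/andP; split.
  apply/unitarymxP; apply: mx2_eq; rewrite mulmx2 !mxE /=;
    apply/eqP; rewrite eq_complex /=; apply/andP; split; apply/eqP;
    by [ring | rewrite -u; ring].
rewrite det_mx2 !mxE /= eq_complex /=; apply/andP; split; apply/eqP;
    by [ring | rewrite -u; ring].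
Qed.

(** SU(2) as the group of unit quaternions t + v with v imaginary. *)
Lemma SU2_quaternion (a : SU2) : exists (t : R) (v : su2),
  SU2val a = t%:C%:M + su2val v /\ t ^+ 2 + su2_dot v v = 1.
Proof.
have /andP[/unitarymxP U /eqP d] := SU2valP a; move: U d.
set A := SU2val a => U; rewrite det_mx2 => d.
have r00 : A 0 0 * (A 0 0)^* + A 0 1 * (A 0 1)^* = 1.
  by have := congr1 (fun M : 'M_2 => M 0 0) U; rewrite mulmx2 !mxE.
have r10 : A 1 0 * (A 0 0)^* + A 1 1 * (A 0 1)^* = 0.
  by have := congr1 (fun M : 'M_2 => M 1 0) U; rewrite mulmx2 !mxE.
have e11 : A 1 1 = (A 0 0)^*.
  transitivity (A 1 1 * (A 0 0 * (A 0 0)^* + A 0 1 * (A 0 1)^*)).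
    by rewrite r00 mulr1.
  transitivity ((A 0 0)^* * (A 0 0 * A 1 1 - A 0 1 * A 1 0) + A 0 1 *
    (A 1 0 * (A 0 0)^* + A 1 1 * (A 0 1)^*)); first by ring.
  by rewrite d r10; ring.
have e10 : A 1 0 = - (A 0 1)^*.
  transitivity (A 1 0 * (A 0 0 * (A 0 0)^* + A 0 1 * (A 0 1)^*)).
    by rewrite r00 mulr1.
  transitivity (A 0 0 * (A 1 0 * (A 0 0)^* + A 1 1 * (A 0 1)^*)
    - (A 0 1)^* * (A 0 0 * A 1 1 - A 0 1 * A 1 0)); first by ring.
  by rewrite d r10; ring.
move: r00 e11 e10; case E0 : (A 0 0) => [p q]; case E1 : (A 0 1) => [r s] r00 e11 e10.
exists p, (su2_mk q r s); split.
  apply: mx2_eq; rewrite mxE !mxE /= ?E0 ?E1 ?e11 ?e10;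
  by apply/eqP; rewrite eq_complex /=; apply/andP; split; apply/eqP; ring.
have /eqP := r00; rewrite eq_complex /= => /andP[/eqP <- _].
by rewrite su2_dot_mk; ring.
Qed.

Lemma su2_AdE (a : SU2) t v X : SU2val a = t%:C%:M + su2val v ->
  su2_Ad a X = (t ^+ 2 - su2_dot v v) *: X + t *: su2_lie v X
    + (2%:R * su2_dot v X) *: v.
Proof.
have /andP[ua _] := SU2valP a.
have [x [y [z ->]]] := su2_mkP v; have [x' [y' [z' ->]]] := su2_mkP X => aE.
rewrite su2_lie_mk !su2_dot_mk !su2_mkZ !su2_mkD; apply: val_inj.
rewrite /su2_Ad /= invmx_unitary // aE; apply: mx2_eq;
rewrite !(mulmx2, mxE) /=;
by apply/eqP; rewrite eq_complex /=; apply/andP; split; apply/eqP; ring.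
Qed.

(** The rotation by the angle pi about a unit vector e. *)
Definition half_turn (e X : su2) : su2 := (2%:R * su2_dot e X) *: e - X.

Lemma half_turn_Ad (e : su2) (u : su2_dot e e = 1) X :
  su2_Ad (MkSU2 (SU2_unit_subproof u)) X = half_turn e X.
Proof.
rewrite (@su2_AdE _ 0 e); last first.
  by rewrite !rmorph0 add0r.
by rewrite u scale0r addr0 expr0n sub0r scaleN1r addrC.
Qed.

Lemma su2_sqr X : su2val X *m su2val X = (- su2_dot X X)%:C%:M.
Proof.
have [x [y [z ->]]] := su2_mkP X.
apply: mx2_eq; rewrite su2_dot_mk mulmx2 !mxE /=;
by apply/eqP; rewrite eq_complex /=; apply/andP; split; apply/eqP; ring.
Qed.

(** If a = t + v and Ad a is involutive, then a^2 = (t^2 - |v|^2) + 2 t v commutes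
    with su(2).  So either t = 0, and Ad a is the half turn about v, or v
    commutes with su(2), and so does a. *)
Lemma su2_Ad_involutive (a : SU2) : (forall X, su2_Ad a (su2_Ad a X) = X) ->
  (forall X, su2_Ad a X = X) \/
  exists e : su2, su2_dot e e = 1 /\ forall X, su2_Ad a X = half_turn e X.
Proof.
have [t [v [aE u]]] := SU2_quaternion a => aa.
have [t0|t0] := eqVneq t 0.
  right; exists v; rewrite t0 expr0n add0r in u; split=> // X.
  by rewrite (su2_AdE _ aE) u t0 scale0r addr0 expr0n sub0r scaleN1r addrC.
left=> X; have /andP[ua _] := SU2valP a.
have ainv : SU2val a \in unitmx := unitarymx_unit ua.
set A := SU2val a in aE ainv.
have AAX : A *m A *m su2val X = su2val X *m (A *m A).
  have := congr1 (fun Y => su2val Y *m (A *m A)) (aa X).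
  rewrite /su2_Ad /= -/A => <-.
  by rewrite -!mulmxA; congr (_ *m _); rewrite (mulmxA (invmx A) A) mulVmx // mul1mx
     mulVmx // mulmx1.
have VX : su2val v *m su2val X = su2val X *m su2val v.
  apply/eqP; rewrite -subr_eq0; apply/eqP.
  have t2 : (2%:R * t)%:C != 0 :> R[i].
    by rewrite fmorph_eq0 mulf_neq0 // pnatr_eq0.
  apply: (scalerI t2); rewrite scaler0.
  have := AAX; rewrite aE !(mulmxDl, mulmxDr) !mul_scalar_mx !mul_mx_scalar.
  move=> /eqP; rewrite -subr_eq0 => /eqP <-.
  have VVX : su2val v *m su2val v *m su2val X = su2val X *m (su2val v *m su2val v).
    by rewrite su2_sqr mul_mx_scalar mul_scalar_mx.
  rewrite VVX -!scalemxAl -!scalemxAr rmorphM rmorph_nat.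
  rewrite !mul_scalar_mx !mul_mx_scalar.
  move: (su2val v *m su2val X) (su2val X *m su2val v) (su2val X *m _) => P Q V.
  apply/matrixP => i j; rewrite !mxE; ring.
apply: val_inj; rewrite /su2_Ad /= -/A.
have -> : A *m su2val X = su2val X *m A.
  by rewrite aE mulmxDl mulmxDr VX mul_scalar_mx mul_mx_scalar.
by rewrite -mulmxA mulmxV // mulmx1.
Qed.

End Ad2.

Section HalfTurn.
Variable R : rcfType.
Implicit Types e X Y : su2 R.

Lemma half_turn_lie e X Y : su2_dot e e = 1 ->
  half_turn e (su2_lie X Y) = su2_lie (half_turn e X) (half_turn e Y).
Proof.
move=> u; rewrite -!(half_turn_Ad u); apply: val_inj => /=.
set a := su2val e; have ai : a \in unitmx.
  by apply: unitarymx_unit; have /andP[] := SU2_unit_subproof u.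
rewrite mulmxBr mulmxBl; congr (_ - _);
  by rewrite !mulmxA mulmxKV.
Qed.

Lemma half_turn_adj e X Y : su2_dot (half_turn e X) Y = su2_dot X (half_turn e Y).
Proof.
rewrite /half_turn su2_dotDl [RHS]su2_dotC su2_dotDl !su2_dotZl !su2_dotNl.
by rewrite (su2_dotC Y X); ring.
Qed.

Lemma half_turn_linear e : linear (half_turn e).
Proof.
move=> a X Y; rewrite /half_turn (su2_dotC e) su2_dotDl su2_dotZl !(su2_dotC e).
by rewrite mulrDr mulrCA scalerDl scalerBr scalerA opprD addrACA.
Qed.

Lemma half_turn0 e : half_turn e 0 = 0.
Proof. by rewrite /half_turn su2_dot0r mulr0 scale0r subr0. Qed.

Lemma half_turn_fix e : su2_dot e e = 1 -> half_turn e e = e.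
Proof. by move=> u; rewrite /half_turn u mulr1 scaler_nat mulr2n addrK. Qed.

Lemma half_turn_opp e X : su2_dot e X = 0 -> half_turn e X = - X.
Proof. by move=> h; rewrite /half_turn h mulr0 scale0r sub0r. Qed.

Lemma half_turnK e X : su2_dot e e = 1 -> half_turn e (half_turn e X) = X.
Proof.
move=> u; rewrite /half_turn [su2_dot e (_ - _)]su2_dotC su2_dotDl su2_dotZl u.
rewrite su2_dotNl (su2_dotC X e).
have -> : 2%:R * (2%:R * su2_dot e X * 1 - su2_dot e X) = 2%:R * su2_dot e X.
  by ring.
by rewrite opprB addrC subrK.
Qed.

(** Both products send X to X - 2 <e, X> e - 2 <e', X> e'. *)
Lemma half_turnC e e' X : su2_dot e e' = 0 ->
  half_turn e (half_turn e' X) = half_turn e' (half_turn e X).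
Proof.
have key e1 e2 : su2_dot e2 e1 = 0 -> half_turn e1 (half_turn e2 X) =
    X - ((2%:R * su2_dot e1 X) *: e1 + (2%:R * su2_dot e2 X) *: e2).
  move=> h; rewrite {1}/half_turn -half_turn_adj half_turn_opp // su2_dotNl.
  by rewrite mulrN scaleNr opprB addrCA opprD.
move=> h; have h' : su2_dot e' e = 0 by rewrite su2_dotC.
by rewrite (key e e' h') (key e' e h) [in RHS](addrC (_ *: e')).
Qed.

End HalfTurn.

(** * su(2) + su(2) *)

Section LieG.
Variable R : rcfType.
Local Notation L := (lieG R).
Implicit Types X Y Z : L.

Definition lieG_dot X Y : R := su2_dot X.1 Y.1 + su2_dot X.2 Y.2.

Lemma lieG_dotC X Y : lieG_dot X Y = lieG_dot Y X.
Proof. by rewrite /lieG_dot !(su2_dotC X.1) !(su2_dotC X.2). Qed.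

Lemma lieG_dot_lin Z : scalar (lieG_dot^~ Z).
Proof.
move=> a X Y; rewrite /lieG_dot /= !su2_dotDl !su2_dotZl; ring.
Qed.

Lemma lieG_dotDl X Y Z : lieG_dot (X + Y) Z = lieG_dot X Z + lieG_dot Y Z.
Proof. by rewrite -[X]scale1r lieG_dot_lin mul1r scale1r. Qed.
Lemma lieG_dotZl a X Z : lieG_dot (a *: X) Z = a * lieG_dot X Z.
Proof. by rewrite /lieG_dot /= !su2_dotZl mulrDr. Qed.
Lemma lieG_dotNr X Z : lieG_dot Z (- X) = - lieG_dot Z X.
Proof. by rewrite /lieG_dot /= !(su2_dotC Z.1) !(su2_dotC Z.2) !su2_dotNl opprD. Qed.

Lemma lieG_dot_ad X Y Z :
  lieG_dot (lieG_bracket X Y) Z = - lieG_dot Y (lieG_bracket X Z).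
Proof. by rewrite /lieG_dot /= !su2_dot_ad opprD. Qed.

Lemma lieG_dot_ge0 X : 0 <= lieG_dot X X.
Proof. by rewrite addr_ge0 ?su2_dot_ge0. Qed.

Section Frames.
Variables (e1 e2 e3 f1 f2 f3 : su2 R).
Hypothesis eF : qframe e1 e2 e3.
Hypothesis fF : qframe f1 f2 f3.

Definition frameG (i : 'I_6) : L :=
  [:: (e1, 0); (e2, 0); (e3, 0); (0, f1); (0, f2); (0, f3)]`_i.

Lemma frameG_expand X : X = \sum_i lieG_dot X (frameG i) *: frameG i.
Proof.
rewrite /frameG !big_ord_recr big_ord0 /= add0r /lieG_dot /= !su2_dot0r.
rewrite !addr0 !add0r; case: X => X1 X2 /=.
rewrite {1}(qframe_expand X1 eF) {1}(qframe_expand X2 fF).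
by congr pair; rewrite /= !scaler0 ?addr0 ?add0r.
Qed.

Lemma frameG_dot i j : lieG_dot (frameG i) (frameG j) = (i == j)%:R.
Proof.
case: eF fF => [[a11 a22 a33] [a12 a13 a23] _] [[b11 b22 b33] [b12 b13 b23] _].
rewrite -(inj_eq val_inj) /frameG /lieG_dot.
case: i => [[|[|[|[|[|[|//]]]]]] ?]; case: j => [[|[|[|[|[|[|//]]]]]] ?] /=;
  by rewrite ?su2_dot0l ?su2_dot0r ?addr0 ?add0r
    ?(a11, a22, a33, b11, b22, b33, a12, a13, a23, b12, b13, b23) //
    su2_dotC ?(a12, a13, a23, b12, b13, b23).
Qed.

Lemma lieG_trace (f : L -> L) : linear f ->
  lftrace f = \sum_i lieG_dot (f (frameG i)) (frameG i).
Proof.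
move=> fl; apply: (@lftrace_dual _ _ _ frameG (fun i v => lieG_dot v (frameG i))) => //.
  by move=> i; exact: lieG_dot_lin.
exact: frameG_expand.
Qed.

Lemma lieG_parseval X Y :
  lieG_dot X Y = \sum_i lieG_dot X (frameG i) * lieG_dot Y (frameG i).
Proof.
rewrite {1}[X]frameG_expand (big_morph (lieG_dot^~ Y) (id1 := 0) (op1 := +%R)).
- by apply: eq_bigr => i _; rewrite lieG_dotZl (lieG_dotC _ Y).
- by move=> U V; rewrite lieG_dotDl.
- by rewrite -(scale0r 0) lieG_dotZl mul0r.
Qed.

Lemma lieG_unimodular (V : L) : lftrace (@lieG_bracket R V) = 0.
Proof.
rewrite lieG_trace => [|a X Y]; last by rewrite linearPr.
rewrite big1 // => i _; have := lieG_dot_ad V (frameG i) (frameG i).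
by rewrite (lieG_dotC (frameG i)) => h; lra.
Qed.

(** By invariance of the inner product tr (ad X)^2 = - sum_i |[X, b_i]|^2, and
    only X = 0 commutes with a whole frame. *)
Lemma lieG_killing_lt0 X : X != 0 ->
  lftrace (fun v : L => lieG_bracket X (lieG_bracket X v) : L) < 0.
Proof.
move=> X0; rewrite lieG_trace => [|a U V]; last by rewrite linearPr /= linearPr.
under eq_bigr do rewrite lieG_dot_ad.
rewrite sumrN oppr_lt0 lt_def sumr_ge0 ?andbT => [|i _]; last exact: lieG_dot_ge0.
apply: contra X0; rewrite psumr_eq0 => [/allP h|i _]; last exact: lieG_dot_ge0.
have z i : lieG_bracket X (frameG i) = 0.
  have := h i (mem_index_enum _); rewrite /= /lieG_dot paddr_eq0 ?su2_dot_ge0 //.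
  move=> /andP[/eqP/su2_dot_eq0 z1 /eqP/su2_dot_eq0 z2].
  by rewrite [LHS]surjective_pairing z1 z2.
have key (a b c d : su2 R) : su2_lie a b = 0 -> su2_lie b c = 2%:R *: d ->
    su2_dot a d = 0.
  move=> ab bc; have := su2_dot_ad b a c; rewrite su2_lieC ab bc oppr0 su2_dot0l.
  by rewrite (su2_dotC a) su2_dotZl su2_dotC; lra.
case: eF fF => [_ _ [l1 l2 l3]] [_ _ [m1 m2 m3]].
have z1 i : su2_lie X.1 (frameG i).1 = 0 := congr1 fst (z i).
have z2 i : su2_lie X.2 (frameG i).2 = 0 := congr1 snd (z i).
rewrite [X]surjective_pairing (qframe_expand X.1 eF) (qframe_expand X.2 fF).
rewrite (key _ _ _ _ (z1 0) l1) (key _ _ _ _ (z1 1) l2) (key _ _ _ _ (z1 2%:R) l3).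
rewrite (key _ _ _ _ (z2 3%:R) m1) (key _ _ _ _ (z2 4%:R) m2) (key _ _ _ _ (z2 5%:R) m3).
by rewrite !scale0r !addr0.
Qed.

End Frames.

End LieG.

Section HalfTurnG.
Variable R : rcfType.
Local Notation L := (lieG R).

Definition half_turnG (e f : su2 R) (X : L) : L := (half_turn e X.1, half_turn f X.2).

Lemma half_turnG_linear e f : linear (half_turnG e f).
Proof. by move=> a X Y; congr pair; exact: half_turn_linear. Qed.

Lemma half_turnGK e f (X : L) : su2_dot e e = 1 -> su2_dot f f = 1 ->
  half_turnG e f (half_turnG e f X) = X.
Proof. by move=> ue uf; rewrite /half_turnG !half_turnK // -surjective_pairing. Qed.

Lemma half_turnG_bracket e f (X Y : L) : su2_dot e e = 1 -> su2_dot f f = 1 ->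
  half_turnG e f (lieG_bracket X Y) =
    lieG_bracket (half_turnG e f X) (half_turnG e f Y).
Proof. by move=> ue uf; congr pair; exact: half_turn_lie. Qed.

Lemma half_turnG_adj e f (X Y : L) :
  lieG_dot (half_turnG e f X) Y = lieG_dot X (half_turnG e f Y).
Proof. by rewrite /lieG_dot /= !half_turn_adj. Qed.

End HalfTurnG.

(** * Einstein metrics preserved by a pair of half turns *)

(** Test the Einstein equation on an eigenvector of g for its largest eigenvalue
    with respect to the bi-invariant inner product. *)
Lemma einstein_const_gt0 (R : realType) (g : {dot lieG R for idfun})
    (D : {bilinear lieG R -> lieG R -> lieG R}) (lambda : R)
    (e1 e2 e3 f1 f2 f3 : su2 R) n (b : 'I_n -> lieG R) :
    qframe e1 e2 e3 -> qframe f1 f2 f3 ->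
    (forall v, v = \sum_i g v (b i) *: b i) ->
    is_levi_civita (@lieG_bracket R) g D ->
    (forall X Y, ricci (@lieG_bracket R) D X Y = lambda * g X Y) ->
  0 < lambda.
Proof.
move=> eF fF bE lc ric; pose F := frameG e1 e2 e3 f1 f2 f3.
have [x [u [u0 gq gu]]] := max_eigenvector g
  (fun i => lieG_dot_lin (F i)) (frameG_expand eF fF)
  (fun i j => etrans (frameG_dot eF fF j i) (congr1 (fun k : bool => k%:R) (eq_sym j i))).
have := ricci_gt0_at_max (@lieG_bracketC R) lc bE (lieG_unimodular eF fF)
  (q := @lieG_dot R) (x := x) (u := u) (fun X Y => lieG_dotNr Y X) (@lieG_dotC R) (@lieG_dot_ad R).
rewrite ric pmulr_lgt0 ?dot_gt0 //; apply.
- by move=> v; have := gq v; rewrite -(lieG_parseval eF fF).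
- by move=> v; have := gu v; rewrite -(lieG_parseval eF fF).
- exact: lieG_killing_lt0 eF fF _ u0.
Qed.

Section HalfTurnPair.
Variables (R : realType) (g : {dot lieG R for idfun}).
Variables (D : {bilinear lieG R -> lieG R -> lieG R}) (lambda : R).
Hypothesis lc : is_levi_civita (@lieG_bracket R) g D.
Hypothesis ric : forall X Y, ricci (@lieG_bracket R) D X Y = lambda * g X Y.
Variables (e1 e2 e3 f1 f2 f3 : su2 R).
Hypotheses (eF : qframe e1 e2 e3) (fF : qframe f1 f2 f3).
Local Notation L := (lieG R).
Local Notation s := (half_turnG e1 f1).
Hypothesis iso : forall X Y, g (s X) (s Y) = g X Y.
Let E1 : L := (e1, 0).
Let E2 : L := (e2, 0).
Let E3 : L := (e3, 0).
Let F1 : L := (0, f1).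
Let F2 : L := (0, f2).
Let F3 : L := (0, f3).
Hypothesis gE2F3 : g E2 F3 = 0.
Hypothesis gE3F2 : g E3 F2 = 0.

Let ue : su2_dot e1 e1 = 1. Proof. by case: eF => [[]]. Qed.
Let uf : su2_dot f1 f1 = 1. Proof. by case: fF => [[]]. Qed.
Let sK X : s (s X) = X. Proof. exact: half_turnGK. Qed.

Let sE : [/\ s E1 = E1, s E2 = - E2, s E3 = - E3, s F1 = F1 & s F2 = - F2 /\ s F3 = - F3].
Proof.
case: eF fF => [_ [a12 a13 _] _] [_ [b12 b13 _] _].
by rewrite /half_turnG /E1 /E2 /E3 /F1 /F2 /F3 /= !half_turn0 !half_turn_fix //
  !half_turn_opp //; do ?split; congr pair; rewrite oppr0.
Qed.

(** sgn b holds on the eigenspace of s for the eigenvalue (-1)^b. *)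
Let sgn (b : bool) X := s X = (-1) ^+ b *: X.

Let sgn_comb b a c X Y : sgn b X -> sgn b Y -> sgn b (a *: X + c *: Y).
Proof.
move=> hX hY; have sl := @half_turnG_linear R e1 f1.
have sZ : s (c *: Y) = c *: s Y.
  have s0 : s 0 = 0 by rewrite /half_turnG !half_turn0.
  by rewrite -[c *: Y]addr0 sl s0 addr0.
by rewrite /sgn sl sZ hX hY !scalerDr !scalerA !(mulrC _ ((-1) ^+ b)).
Qed.

Let sgnE : [/\ sgn false E1, sgn false F1, sgn true E2, sgn true E3 & sgn true F2 /\ sgn true F3].
Proof.
by case: sE => h1 h2 h3 h4 [h5 h6]; rewrite /sgn !expr0 !expr1 !scale1r !scaleN1r.
Qed.

Let orth X Y : sgn false X -> sgn true Y -> g X Y = 0.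
Proof.
move=> hX hY; have := iso X Y.
by rewrite hX hY scale1r scaleN1r dotNr; lra.
Qed.

(** s is an isometric automorphism, so it commutes with D by Koszul's formula. *)
Let Dsgn X Y Z a b c : sgn a X -> sgn b Y -> sgn c Z -> a (+) b (+) c ->
  g (D X Y) Z = 0.
Proof.
move=> hX hY hZ odd.
have e : g (D (s X) (s Y)) (s Z) = g (D X Y) Z.
  apply: (@mulfI _ 2%:R); first by rewrite pnatr_eq0.
  by rewrite !(koszul lc) /= -!half_turnG_bracket // !iso.
move: e; rewrite hX hY hZ lcZl lcZr !dotE.
by case: a b c odd {hX hY hZ} => [] [] [] // _; rewrite ?expr0 ?expr1; lra.
Qed.

(** The Einstein equation is paired with the vectors g-dual to the frame, where
    it reduces to the vanishing of the form Bf below on (w E2, w E3) and on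
    (w F2, w F3).  Weighting these two equations with g(E2, E3) and g(F2, F3)
    and passing to principal bases of the planes (E2, F2) and (E3, F3) leaves a
    sum of terms of one sign. *)
Lemma einstein_frame_diagonal : g E2 E3 = 0 /\ g F2 F3 = 0.
Proof.
case: sgnE => sE1 sF1 sE2 sE3 [sF2 sF3].
case: eF => [[a11 a22 a33] [a12 a13 a23] [l1 l2 l3]].
case: fF => [[b11 b22 b33] [b12 b13 b23] [m1 m2 m3]].
have dotEs := (su2_dot0l, su2_dot0r, addr0, add0r, a11, a22, a33, a12, a13, a23,
  b11, b22, b33, b12, b13, b23).
have nz (X Y : L) : lieG_dot X Y = 1 -> X != 0.
  move=> h; apply/eqP => X0; move: h; rewrite X0 /lieG_dot /= !su2_dot0l addr0.
  by move/eqP; rewrite eq_sym oner_eq0.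
have np (X Y Z : L) : lieG_dot Y Z = 1 -> lieG_dot X Z = 0 -> forall t, Y != t *: X.
  move=> h h0 t; apply/eqP => YE; move: h.
  by rewrite YE lieG_dotZl h0 mulr0 => /eqP; rewrite eq_sym oner_eq0.
(* T1, T2 is an orthonormal basis of the fixed plane of s *)
have [T1 [T2 [pT T11 T22 T12]]] : exists U W,
    [/\ same_plane E1 F1 U W, g U U = 1, g W W = 1 & g U W = 0].
  apply: gram_schmidt2; first by apply: (nz _ E1); rewrite /lieG_dot /= !dotEs.
  by apply: (np _ _ F1); rewrite /lieG_dot /= !dotEs.
have dis a b a' b' : a *: E2 + b *: F2 = a' *: E3 + b' *: F3 -> a *: E2 + b *: F2 = 0.
  move=> h; have := congr1 ((@lieG_dot R)^~ E2) h; have := congr1 ((@lieG_dot R)^~ F2) h.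
  rewrite !lieG_dotDl !lieG_dotZl /lieG_dot /= !dotEs (su2_dotC e3) (su2_dotC f3).
  by rewrite !dotEs !mulr0 !mulr1 !dotEs => -> ->; rewrite !scale0r addr0.
have [v1 [v2 [v1' [v2' [pv pv' onv onv' cross]]]]] :
    exists v1 v2 v1' v2', [/\ same_plane E2 F2 v1 v2, same_plane E3 F3 v1' v2',
    [/\ g v1 v1 = 1, g v2 v2 = 1 & g v1 v2 = 0],
    [/\ g v1' v1' = 1, g v2' v2' = 1 & g v1' v2' = 0] &
    [/\ g v1 v2' = 0, g v2 v1' = 0, 0 < 1 - g v1 v1' ^+ 2 & 0 < 1 - g v2 v2' ^+ 2]].
  apply: principal_bases dis.
  - by apply: (nz _ E2); rewrite /lieG_dot /= !dotEs.
  - by apply: (np _ _ F2); rewrite /lieG_dot /= !dotEs.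
  - by apply: (nz _ E3); rewrite /lieG_dot /= !dotEs.
  - by apply: (np _ _ F3); rewrite /lieG_dot /= !dotEs.
have [t1 [u1 [t2 [u2 [? [? [? [? [T1E T2E _ _]]]]]]]]] := pT.
have [al1 [be1 [al2 [be2 [p1 [q1 [p2 [q2 [v1E v2E E2E F2E]]]]]]]]] := pv.
have [al1' [be1' [al2' [be2' [p1' [q1' [p2' [q2' [v1'E v2'E E3E F3E]]]]]]]]] := pv'.
have sT1 : sgn false T1 by rewrite T1E; apply: sgn_comb.
have sT2 : sgn false T2 by rewrite T2E; apply: sgn_comb.
have sv1 : sgn true v1 by rewrite v1E; apply: sgn_comb.
have sv2 : sgn true v2 by rewrite v2E; apply: sgn_comb.
have sv1' : sgn true v1' by rewrite v1'E; apply: sgn_comb.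
have sv2' : sgn true v2' by rewrite v2'E; apply: sgn_comb.
have onT : [/\ g T1 T1 = 1, g T2 T2 = 1 & g T1 T2 = 0] by [].
have Tv1 : [/\ g T1 v1 = 0, g T1 v2 = 0, g T1 v1' = 0 & g T1 v2' = 0].
  by split; apply: orth.
have Tv2 : [/\ g T2 v1 = 0, g T2 v2 = 0, g T2 v1' = 0 & g T2 v2' = 0].
  by split; apply: orth.
pose b := adapted_basis g T1 T2 v1 v2 v1' v2'.
have bE v : v = \sum_i g v (b i) *: b i.
  exact: (adapted_expand (dim_lieG R) onT onv onv' cross Tv1 Tv2).
have lam0 : 0 < lambda := einstein_const_gt0 eF fF bE lc ric.
pose P (i : 'I_6) := (i < 2)%N.
have sb i : sgn (~~ P i) (b i).
  rewrite /b /adapted_basis /P; case: i => [[|[|[|[|[|[|//]]]]]] ?] //=;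
  by rewrite scalerBr scalerA -scaleNr; apply: sgn_comb.
(* w Y represents the functional <Y, -> with respect to g *)
pose w (Y : L) : L := \sum_i lieG_dot Y (b i) *: b i.
have wE Y v : g (w Y) v = lieG_dot Y v.
  rewrite dot_suml; under eq_bigr do rewrite dotZl (dotC g _ v).
  rewrite lieG_dotC {2}(bE v) (big_morph ((@lieG_dot R)^~ Y) (id1 := 0) (op1 := +%R)).
  - by apply: eq_bigr => i _; rewrite lieG_dotZl mulrC lieG_dotC.
  - by move=> U V; rewrite lieG_dotDl.
  - by rewrite -(scale0r 0) lieG_dotZl mul0r.
have sw Y : sgn true Y -> sgn true (w Y).
  move=> sY; apply: (@dot_inj _ _ g) => Z.
  rewrite -[Z]sK iso wE -half_turnG_adj sY expr1 !scaleN1r dotNl wE sK.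
  by rewrite lieG_dotC lieG_dotNr lieG_dotC.
pose Bf X Y := lambda * g X Y + 2%:R * \sum_(i | P i) g (D (b i) X) (D (b i) Y).
(* in ricci_split the term g (w Y') [b i, D (b i) (w Y)] is a multiple of
   <Y, D (b i) (w Y)> = g (w Y) (D (b i) (w Y)) = 0, and so is the other one *)
have K0 Y Y' (c : 'I_6 -> R) : sgn true Y -> sgn true Y' ->
    (forall i, P i -> lieG_bracket (b i) Y = c i *: Y') ->
    (forall i, P i -> lieG_bracket (b i) Y' = - c i *: Y) ->
    Bf (w Y) (w Y') = 0.
  move=> sY sY' h h'.
  have Hp i j : P i -> P j -> g (D (b i) (w Y')) (b j) = 0.
    move=> Pi Pj; have := sb i; have := sb j; rewrite Pi Pj => sj si.
    exact: (Dsgn si (sw _ sY') sj).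
  have Hm i j : ~~ P i -> ~~ P j -> g (D (b i) (w Y)) (b j) = 0.
    move=> Pi Pj; have := sb i; have := sb j; rewrite Pi Pj => sj si.
    exact: (Dsgn si (sw _ sY) sj).
  have := ricci_split (@lieG_bracketC R) lc bE (lieG_unimodular eF fF) Hp Hm.
  rewrite ric /Bf => ->.
  rewrite mulr_sumr -sumrN -big_split big1 //= => i Pi.
  have e1' : g (w Y') (lieG_bracket (b i) (D (b i) (w Y))) = 0.
    rewrite wE; have := lieG_dot_ad (b i) Y' (D (b i) (w Y)).
    rewrite h' // lieG_dotZl -wE dotC (lc_skew0 lc); lra.
  have e2' : g (w Y) (lieG_bracket (b i) (D (b i) (w Y'))) = 0.
    rewrite wE; have := lieG_dot_ad (b i) Y (D (b i) (w Y')).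
    rewrite h // lieG_dotZl -wE dotC (lc_skew0 lc); lra.
  by rewrite e1' e2'; ring.
pose ct (i : 'I_6) := if i == 0 then t1 else t2.
pose cu (i : 'I_6) := if i == 0 then u1 else u2.
have bT i : P i -> b i = ct i *: E1 + cu i *: F1.
  rewrite /b /adapted_basis /P /ct /cu; case: i => [[|[|//]] ?] _ /=.
    by rewrite T1E.
  by rewrite T2E.
have brE2 i : P i -> lieG_bracket (b i) E2 = (2%:R * ct i) *: E3.
  move=> /bT ->; congr pair => /=.
    by rewrite scaler0 addr0 su2_lieZl l1 scalerA mulrC.
  by rewrite su2_lie0r scaler0.
have brE3 i : P i -> lieG_bracket (b i) E3 = - (2%:R * ct i) *: E2.
  move=> /bT ->; congr pair => /=.
    by rewrite scaler0 addr0 su2_lieZl su2_lieC l3 -scalerN scalerA mulrC scalerN scaleNr.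
  by rewrite su2_lie0r scaler0.
have brF2 i : P i -> lieG_bracket (b i) F2 = (2%:R * cu i) *: F3.
  move=> /bT ->; congr pair => /=.
    by rewrite su2_lie0r scaler0.
  by rewrite scaler0 add0r su2_lieZl m1 scalerA mulrC.
have brF3 i : P i -> lieG_bracket (b i) F3 = - (2%:R * cu i) *: F2.
  move=> /bT ->; congr pair => /=.
    by rewrite su2_lie0r scaler0.
  by rewrite scaler0 add0r su2_lieZl su2_lieC m3 -scalerN scalerA mulrC scalerN scaleNr.
have BE := K0 _ _ _ sE2 sE3 brE2 brE3.
have BF := K0 _ _ _ sF2 sF3 brF2 brF3.
pose x := g v1 v1'; pose y := g v2 v2'.
pose d1 := dual1 g v1 v1'; pose d1' := dual1' g v1 v1'.
pose d2 := dual2 g v2 v2'; pose d2' := dual2' g v2 v2'.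
have wdual Y : lieG_dot Y E1 = 0 -> lieG_dot Y F1 = 0 -> w Y =
    (al1 * lieG_dot Y E2 + be1 * lieG_dot Y F2) *: d1
    + (al2 * lieG_dot Y E2 + be2 * lieG_dot Y F2) *: d2
    + (al1' * lieG_dot Y E3 + be1' * lieG_dot Y F3) *: d1'
    + (al2' * lieG_dot Y E3 + be2' * lieG_dot Y F3) *: d2'.
  move=> h1 h2.
  have dr a c U V : lieG_dot Y (a *: U + c *: V) = a * lieG_dot Y U + c * lieG_dot Y V.
    by rewrite !(lieG_dotC Y) lieG_dotDl !lieG_dotZl.
  rewrite {1}(dual_expand (dim_lieG R) onT onv onv' cross Tv1 Tv2 (v := w Y)).
  - have r1 : lieG_dot Y v1 = al1 * lieG_dot Y E2 + be1 * lieG_dot Y F2 by rewrite v1E dr.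
    have r2 : lieG_dot Y v2 = al2 * lieG_dot Y E2 + be2 * lieG_dot Y F2 by rewrite v2E dr.
    have r3 : lieG_dot Y v1' = al1' * lieG_dot Y E3 + be1' * lieG_dot Y F3 by rewrite v1'E dr.
    have r4 : lieG_dot Y v2' = al2' * lieG_dot Y E3 + be2' * lieG_dot Y F3 by rewrite v2'E dr.
    by rewrite !wE r1 r2 r3 r4.
  - by rewrite wE T1E dr h1 h2 !mulr0 addr0.
  - by rewrite wE T2E dr h1 h2 !mulr0 addr0.
have dots : [/\ su2_dot e2 e1 = 0, su2_dot e3 e1 = 0, su2_dot e3 e2 = 0,
    su2_dot f2 f1 = 0 & su2_dot f3 f1 = 0 /\ su2_dot f3 f2 = 0].
  by rewrite !(su2_dotC e3) !(su2_dotC f3) (su2_dotC e2) (su2_dotC f2).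
case: dots => a21 a31 a32 b21 [b31 b32].
have wE2 : w E2 = al1 *: d1 + al2 *: d2.
  rewrite wdual /lieG_dot /= !dotEs ?a21 //.
  by rewrite !(mulr0, mulr1, addr0, add0r, scale0r).
have wF2 : w F2 = be1 *: d1 + be2 *: d2.
  rewrite wdual /lieG_dot /= !dotEs ?b21 //.
  by rewrite !(mulr0, mulr1, addr0, add0r, scale0r).
have wE3 : w E3 = al1' *: d1' + al2' *: d2'.
  rewrite wdual /lieG_dot /= !dotEs ?a31 ?a32 //.
  by rewrite !(mulr0, mulr1, addr0, add0r, scale0r).
have wF3 : w F3 = be1' *: d1' + be2' *: d2'.
  rewrite wdual /lieG_dot /= !dotEs ?b31 ?b32 //.
  by rewrite !(mulr0, mulr1, addr0, add0r, scale0r).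
have BfD a c a' c' X X' Y Y' :
    Bf (a *: X + c *: X') (a' *: Y + c' *: Y') =
    a * a' * Bf X Y + a * c' * Bf X Y' + c * a' * Bf X' Y + c * c' * Bf X' Y'.
  rewrite /Bf; have -> : \sum_(i | P i) g (D (b i) (a *: X + c *: X'))
      (D (b i) (a' *: Y + c' *: Y')) =
      a * a' * \sum_(i | P i) g (D (b i) X) (D (b i) Y) +
      a * c' * \sum_(i | P i) g (D (b i) X) (D (b i) Y') +
      c * a' * \sum_(i | P i) g (D (b i) X') (D (b i) Y) +
      c * c' * \sum_(i | P i) g (D (b i) X') (D (b i) Y').
    rewrite !mulr_sumr -!big_split /=; apply: eq_bigr => i _.
    by rewrite !lcDr !lcZr !dotE; ring.
  by rewrite !dotE; ring.
pose dE := g E2 E3; pose dF := g F2 F3.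
have gvv a c a' c' : g (a *: E2 + c *: F2) (a' *: E3 + c' *: F3) =
    dE * (a * a') + dF * (c * c').
  by rewrite !dotE gE2F3 (dotC g F2 E3) gE3F2 /dE /dF; ring.
have [c12 c21 Dx Dy] := cross.
(* the matrix of g between the two planes is diagonal both in the given and in
   the principal bases, so its contraction with Bf has two terms in each *)
have sum0 : x * Bf d1 d1' + y * Bf d2 d2' = 0.
  have h11 : x = dE * (al1 * al1') + dF * (be1 * be1') by rewrite -gvv -v1E -v1'E.
  have h22 : y = dE * (al2 * al2') + dF * (be2 * be2') by rewrite -gvv -v2E -v2'E.
  have h12 : dE * (al1 * al2') + dF * (be1 * be2') = 0 by rewrite -gvv -v1E -v2'E.
  have h21 : dE * (al2 * al1') + dF * (be2 * be1') = 0 by rewrite -gvv -v2E -v1'E.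
  transitivity (dE * Bf (w E2) (w E3) + dF * Bf (w F2) (w F3)
    - (dE * (al1 * al2') + dF * (be1 * be2')) * Bf d1 d2'
    - (dE * (al2 * al1') + dF * (be2 * be1')) * Bf d2 d1').
    by rewrite wE2 wE3 wF2 wF3 !BfD h11 h22; ring.
  by rewrite BE BF h12 h21; ring.
have [n1 n2 n12] := onv; have [n1' n2' n12'] := onv'.
have Dx0 : 1 - x ^+ 2 != 0 by rewrite lt0r_neq0.
have Dy0 : 1 - y ^+ 2 != 0 by rewrite lt0r_neq0.
have gd1 : g d1 d1' = - (x / (1 - x ^+ 2)).
  rewrite /d1 /d1' /dual1 /dual1' !dotE (dotC g v1' v1) n1 n1' -/x; field.
  exact: Dx0.
have gd2 : g d2 d2' = - (y / (1 - y ^+ 2)).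
  rewrite /d2 /d2' /dual2 /dual2' !dotE (dotC g v2' v2) n2 n2' -/y; field.
  exact: Dy0.
(* Koszul: [E2, F2] = 0, [b i, E2] and [b i, F2] are multiples of E3 and F3,
   and g E3 F2 = g E2 F3 = 0 *)
have kEF i : P i -> g (D (b i) E2) F2 = 0.
  move=> Pi; apply: (@mulfI _ 2%:R); first by rewrite pnatr_eq0.
  rewrite (koszul lc) /= brE2 // [lieG_bracket F2 (b i)]lieG_bracketC brF2 //.
  have -> : lieG_bracket E2 F2 = 0.
    by congr pair; rewrite /= ?su2_lie0r ?su2_lie0l.
  by rewrite !dotE gE3F2 (dotC g F3) gE2F3; ring.
have kEF' i : P i -> g (D (b i) E3) F3 = 0.
  move=> Pi; apply: (@mulfI _ 2%:R); first by rewrite pnatr_eq0.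
  rewrite (koszul lc) /= brE3 // [lieG_bracket F3 (b i)]lieG_bracketC brF3 //.
  have -> : lieG_bracket E3 F3 = 0.
    by congr pair; rewrite /= ?su2_lie0r ?su2_lie0l.
  by rewrite !dotE gE2F3 (dotC g F2) gE3F2; ring.
have k0 i X Y a c a' c' : g (D (b i) X) Y = 0 ->
    g (D (b i) (a *: X + c *: Y)) (a' *: X + c' *: Y) = 0.
  move=> h; rewrite lcDr !lcZr !dotE !(lc_skew0 lc) h (lc_skew lc) (dotC g Y) h.
  by ring.
have neg i : P i -> x * g (D (b i) d1) (D (b i) d1') + y * g (D (b i) d2) (D (b i) d2') <= 0.
  move=> Pi; apply: (principal_sum_le0 (dim_lieG R) onT onv onv' cross Tv1 Tv2).
  - by move=> a X Y; rewrite linearPr.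
  - by move=> X Y; exact: (lc_skew lc).
  - by rewrite v1E v2E k0 // kEF.
  - by rewrite v1'E v2'E k0 // kEF'.
  move=> X XL; have sX : sgn true X.
    by move: XL; rewrite !inE => /or4P[] /eqP ->.
  have := sb i; rewrite Pi => si.
  by split; [apply: (Dsgn si sX sT1) | apply: (Dsgn si sX sT2)].
have sumle : \sum_(i | P i) (x * g (D (b i) d1) (D (b i) d1')
     + y * g (D (b i) d2) (D (b i) d2')) <= 0.
  by apply: sumr_le0.
have tot : lambda * (x ^+ 2 / (1 - x ^+ 2) + y ^+ 2 / (1 - y ^+ 2)) <= 0.
  move: sum0; rewrite /Bf gd1 gd2.
  rewrite big_split /= -!mulr_sumr in sumle.
  move: sumle; set S1 := \sum_(i | _) _; set S2 := \sum_(i | _) _ => le eq0.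
  have -> : lambda * (x ^+ 2 / (1 - x ^+ 2) + y ^+ 2 / (1 - y ^+ 2)) =
     2%:R * (x * S1 + y * S2) -
     (x * (lambda * - (x / (1 - x ^+ 2)) + 2%:R * S1)
      + y * (lambda * - (y / (1 - y ^+ 2)) + 2%:R * S2)) by ring.
  by rewrite eq0 subr0 pmulr_rle0 // ltr0n.
have px : 0 <= x ^+ 2 / (1 - x ^+ 2) by rewrite divr_ge0 ?sqr_ge0 // ltW.
have py : 0 <= y ^+ 2 / (1 - y ^+ 2) by rewrite divr_ge0 ?sqr_ge0 // ltW.
rewrite pmulr_rle0 // in tot.
have : x ^+ 2 / (1 - x ^+ 2) + y ^+ 2 / (1 - y ^+ 2) == 0.
  by rewrite eq_le tot addr_ge0.
rewrite paddr_eq0 // !mulf_eq0 !invr_eq0 (negPf Dx0) (negPf Dy0) !orbF !orbb.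
move=> /andP[/eqP x0 /eqP y0].
have fin a c a' c' : g (a *: v1 + c *: v2) (a' *: v1' + c' *: v2') = 0.
  by rewrite !dotE -/x -/y x0 y0 c12 c21; ring.
by rewrite E2E E3E F2E F3E !fin.
Qed.

End HalfTurnPair.

(** * Klein four groups of involutions *)

Section Klein.
Variables (R : realFieldType) (L : vectType R) (f h : 'End(L)).
Hypotheses (ff : (f \o f)%VF = \1%VF) (hh : (h \o h)%VF = \1%VF).
Hypothesis fh : (f \o h)%VF = (h \o f)%VF.

Lemma involution_inv (k : 'End(L)) : (k \o k)%VF = \1%VF -> (k^-1)%VF = k.
Proof.
move=> kk; have k0 : lker k == 0%VS.
  apply/lker0P => x y e; have := congr1 (fun F : 'End(L) => F x) kk.
  by rewrite comp_lfunE id_lfunE e -(comp_lfunE k k) kk id_lfunE.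
by rewrite -[LHS]comp_lfun1r -kk comp_lfunA lker0_compVf // comp_lfun1l.
Qed.

Let fhfh : ((f \o h) \o (f \o h))%VF = \1%VF.
Proof. by rewrite {1}fh comp_lfunA -[((h \o f) \o f)%VF]comp_lfunA ff comp_lfun1r hh. Qed.

Lemma generated_commuting k : generated [set f; h] k ->
  [\/ k = \1%VF, k = f, k = h | k = (f \o h)%VF].
Proof.
have hfC : (h \o f)%VF = (f \o h)%VF by [].
have ffh k' : (f \o (f \o k'))%VF = k' by rewrite comp_lfunA ff comp_lfun1l.
have hhk k' : (h \o (h \o k'))%VF = k' by rewrite comp_lfunA hh comp_lfun1l.
have hfk k' : (h \o (f \o k'))%VF = (f \o (h \o k'))%VF by rewrite !comp_lfunA fh.
elim=> [k' [->|->]|||].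
- by constructor 2.
- by constructor 3.
- by constructor 1.
- move=> k1 k2 _ H1 _ H2; move: H1 H2.
  case=> ->; case=> ->; rewrite ?comp_lfun1l ?comp_lfun1r -?comp_lfunA;
  rewrite ?ffh ?hfk ?hhk ?ff ?hh ?hfC ?ffh ?hh ?comp_lfun1r;
  by [constructor 1 | constructor 2 | constructor 3 | constructor 4].
move=> k' _ [] ->; rewrite involution_inv ?comp_lfun1l //.
- by constructor 1.
- by constructor 2.
- by constructor 3.
- by constructor 4.
Qed.

Lemma klein_four_commuting : f != \1%VF -> h != \1%VF -> f != h ->
  klein_four (generated [set f; h]).
Proof.
move=> f1 h1 nfh.
pose p (b : 'Z_2) (k : 'End(L)) : 'End(L) := if b == 0 then \1%VF else k.
have Z2 (b : 'Z_2) : b = 0 \/ b = 1.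
  by case: b => [[|[|//]] ?]; [left|right]; apply: val_inj.
exists (fun x => (p x.1 f \o p x.2 h)%VF); split.
- have fh1 : (f \o h)%VF != \1%VF.
    apply: contra nfh => /eqP e; apply/eqP.
    by rewrite -[LHS]comp_lfun1r -hh comp_lfunA e comp_lfun1l.
  have fhf : (f \o h)%VF != f.
    apply: contra h1 => /eqP e; apply/eqP.
    by rewrite -[LHS]comp_lfun1l -ff -comp_lfunA e.
  have fhh : (f \o h)%VF != h.
    apply: contra f1 => /eqP e; apply/eqP.
    by rewrite -[LHS]comp_lfun1r -hh comp_lfunA e.
  move: f1 h1 nfh fh1 fhf fhh => /eqP n1 /eqP n2 /eqP n3 /eqP n4 /eqP n5 /eqP n6.
  move=> [a b] [c d]; rewrite /p /=.
  case: (Z2 a) (Z2 b) (Z2 c) (Z2 d) => -> [] -> [] -> [] -> //=;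
    rewrite ?comp_lfun1l ?comp_lfun1r // => e; exfalso;
    by [apply: n1 | apply: n2 | apply: n3 | apply: n4 | apply: n5 | apply: n6 |
        apply: n1; rewrite -e | apply: n2; rewrite -e | apply: n3; rewrite -e |
        apply: n4; rewrite -e | apply: n5; rewrite -e | apply: n6; rewrite -e].
- move=> [a b] [c d]; rewrite /p /=.
  have ffh k' : (f \o (f \o k'))%VF = k' by rewrite comp_lfunA ff comp_lfun1l.
  have hfk k' : (h \o (f \o k'))%VF = (f \o (h \o k'))%VF by rewrite !comp_lfunA fh.
  case: (Z2 a) (Z2 b) (Z2 c) (Z2 d) => -> [] -> [] -> [] -> //=;
  rewrite ?comp_lfun1l ?comp_lfun1r -?comp_lfunA ?comp_lfun1l ?comp_lfun1r;
  by rewrite ?ffh ?hfk -?fh ?ff ?hh ?ffh ?hh ?comp_lfun1r.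
apply/seteqP; split=> k /=.
  move=> [[a b] _ <-] /=; apply: generated_comp.
    rewrite /p; case: ifP => _; first exact: generated_id.
    by apply: generated_in; left.
  rewrite /p; case: ifP => _; first exact: generated_id.
  by apply: generated_in; right.
move=> /generated_commuting [] ->.
- by exists (0, 0) => //; rewrite /p /= comp_lfun1l.
- by exists (1, 0) => //; rewrite /p /= comp_lfun1r.
- by exists (0, 1) => //; rewrite /p /= comp_lfun1l.
- by exists (1, 1).
Qed.

End Klein.

(** * The theorem *)

Section AdjointGroup.
Variable R : rcfType.
Local Notation L := (lieG R).

Lemma AdG_comp (f h : 'End(L)) : AdG f -> AdG h -> AdG (f \o h)%VF.
Proof.
move=> [a _ <-] [b _ <-].
have mulP (p q : SU2 R) : SU2val p *m SU2val q \in @SU2_pred R.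
  have /andP[up /eqP dp] := SU2valP p; have /andP[uq /eqP dq] := SU2valP q.
  by apply/andP; split; [exact: mul_unitarymx | rewrite det_mulmx dp dq mulr1].
have AdM (p q : SU2 R) X : su2_Ad (MkSU2 (mulP p q)) X = su2_Ad p (su2_Ad q X).
  have up : SU2val p \in unitmx by have /andP[/unitarymx_unit] := SU2valP p.
  have uq : SU2val q \in unitmx by have /andP[/unitarymx_unit] := SU2valP q.
  apply: val_inj => /=.
  have -> : invmx (SU2val p *m SU2val q) = invmx (SU2val q) *m invmx (SU2val p).
    have upq : SU2val p *m SU2val q \in unitmx by rewrite unitmx_mul up.
    apply: (can_inj (mulKmx upq)); rewrite mulmxV //.
    by rewrite -mulmxA (mulmxA (SU2val q)) mulmxV // mul1mx mulmxV.
  by rewrite !mulmxA.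
exists (MkSU2 (mulP a.1 b.1), MkSU2 (mulP a.2 b.2)) => //.
by apply/lfunP => X; rewrite comp_lfunE !lfunE /= /Ad /= !AdM.
Qed.

Lemma AdG_half_turnG (e f : su2 R) : su2_dot e e = 1 -> su2_dot f f = 1 ->
  exists2 t : 'End(L), AdG t & forall X, t X = half_turnG e f X.
Proof.
move=> ue uf.
exists (linfun (Ad (MkSU2 (SU2_unit_subproof ue), MkSU2 (SU2_unit_subproof uf)))).
  by eexists.
by move=> X; rewrite lfunE /= /Ad /= !half_turn_Ad.
Qed.

(** A map with signs for eigenvalues preserves g as soon as its two eigenspaces
    are orthogonal; the basis b itself need not be orthogonal. *)
Lemma frame_signs_isometry (g : {dot L for idfun}) (f : L -> L) (b : 'I_6 -> L)
    (c : L -> 'I_6 -> R) (sg : 'I_6 -> bool) :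
    linear f -> (forall v, v = \sum_i c v i *: b i) ->
    (forall i, f (b i) = (-1) ^+ sg i *: b i) ->
    (forall i j, sg i -> ~~ sg j -> g (b i) (b j) = 0) ->
  forall X Y, g (f X) (f Y) = g X Y.
Proof.
move=> fl bE fb go X Y.
have fE v : f v = \sum_i c v i *: f (b i) by rewrite {1}(bE v) linear_sum_scale.
rewrite !fE {2}(bE X) {2}(bE Y) !dot_suml; apply: eq_bigr => i _.
rewrite !dot_sumr; apply: eq_bigr => j _; rewrite !fb !dotE.
have [eqs|ne] := eqVneq (sg i) (sg j).
  have := sqrr_sign R (sg j); rewrite eqs; set t := _ ^+ sg j => t2.
  by rewrite -[RHS]mul1r -t2; ring.
have -> : g (b i) (b j) = 0.
  case: (boolP (sg i)) ne => si; case: (boolP (sg j)) => sj // _.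
    exact: go.
  by rewrite dotC go.
by rewrite !mulr0.
Qed.

End AdjointGroup.

Theorem theorem1p2 (R : realType) (g : {dot lieG R for idfun})
    (sigma : 'End(lieG R)) :
  is_einstein (@lieG_bracket R) g ->
  inner_involution sigma ->
  preserves_metric g sigma ->
  lftrace sigma = - 2%:R ->
  exists tau : 'End(lieG R),
    [/\ inner_involution tau,
        (sigma \o tau)%VF = (tau \o sigma)%VF,
        klein_four (generated [set sigma; tau]) &
        generated [set sigma; tau] `<=` AdG_preserving g].
Proof.
move=> [D lc [lambda ric]] [sA ss s1] spres str.
have [e1 [f1 [ue uf sE]]] : exists e1 f1 : su2 R, [/\ su2_dot e1 e1 = 1,
    su2_dot f1 f1 = 1 & forall X, sigma X = half_turnG e1 f1 X].
  have [a _ aE] := sA.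
  have sX X : sigma X = (su2_Ad a.1 X.1, su2_Ad a.2 X.2) by rewrite -aE lfunE.
  have inv X : sigma (sigma X) = X by rewrite -comp_lfunE ss id_lfunE.
  have i1 : forall X, su2_Ad a.1 (su2_Ad a.1 X) = X.
    by move=> X; have := congr1 fst (inv (X, 0)); rewrite !sX.
  have i2 : forall X, su2_Ad a.2 (su2_Ad a.2 X) = X.
    by move=> X; have := congr1 snd (inv (0, X)); rewrite !sX.
  have u0 : su2_dot (su2_mk 1 0 0) (su2_mk 1 0 0 : su2 R) = 1.
    by rewrite su2_dot_mk; ring.
  have lin : linear sigma by move=> k X Y; rewrite linearP.
  have tr e1 e2 e3 f1 f2 f3 : qframe e1 e2 e3 -> qframe f1 f2 f3 ->
      su2_dot (su2_Ad a.1 e1) e1 + su2_dot (su2_Ad a.1 e2) e2 +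
      su2_dot (su2_Ad a.1 e3) e3 + su2_dot (su2_Ad a.2 f1) f1 +
      su2_dot (su2_Ad a.2 f2) f2 + su2_dot (su2_Ad a.2 f3) f3 = - 2%:R.
    move=> eF fF; rewrite -str (lieG_trace eF fF lin) !big_ord_recr big_ord0 /=.
    by rewrite /frameG /= !sX /lieG_dot /= !su2_dot0r !addr0 !add0r.
  have ht (e1 e2 e3 : su2 R) : qframe e1 e2 e3 -> su2_dot (half_turn e1 e1) e1 +
      su2_dot (half_turn e1 e2) e2 + su2_dot (half_turn e1 e3) e3 = - 1.
    move=> [[a11 a22 a33] [a12 a13 _] _].
    by rewrite half_turn_fix // !half_turn_opp // !su2_dotNl a11 a22 a33; ring.
  have idt (e1 e2 e3 : su2 R) : qframe e1 e2 e3 -> su2_dot e1 e1 +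
      su2_dot e2 e2 + su2_dot e3 e3 = 3%:R :> R.
    by move=> [[-> -> ->] _ _]; ring.
  (* a component that is the identity has trace 3, a half turn has trace -1 *)
  have [i2' [i3' iF]] := qframe_exists u0.
  case: (su2_Ad_involutive i1) (su2_Ad_involutive i2) => [h1|[e [ue h1]]] [h2|[f [uf h2]]].
  - by have := tr _ _ _ _ _ _ iF iF; rewrite !h1 !h2; have := idt _ _ _ iF; lra.
  - have [f2 [f3 fF]] := qframe_exists uf.
    have := tr _ _ _ _ _ _ iF fF; rewrite !h1 !h2.
    by have := idt _ _ _ iF; have := ht _ _ _ fF; lra.
  - have [e2 [e3 eF]] := qframe_exists ue.
    have := tr _ _ _ _ _ _ eF iF; rewrite !h1 !h2.
    by have := idt _ _ _ iF; have := ht _ _ _ eF; lra.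
  by exists e, f; split=> // X; rewrite sX h1 h2.
(* complete e1 and f1 to frames and rotate these so that the matrix of g between
   the spans of e2, e3 and of f2, f3 is diagonal *)
have [k2 [k3 kF]] := qframe_exists ue; have [l2 [l3 lF]] := qframe_exists uf.
have [c1 [s1' [c2 [s2 [cs1 cs2 h1 h2]]]]] := svd2
  (g (k2, 0) (0, l2)) (g (k2, 0) (0, l3)) (g (k3, 0) (0, l2)) (g (k3, 0) (0, l3)).
have eF := qframe_rot cs1 kF; have fF := qframe_rot cs2 lF.
move: eF fF; set e2 := c1 *: k2 + _; set e3 := - s1' *: k2 + _.
set f2 := c2 *: l2 + _; set f3 := - s2 *: l2 + _ => eF fF.
have inl c s (X Y : su2 R) :
    (c *: X + s *: Y, 0) = c *: ((X, 0) : lieG R) + s *: ((Y, 0) : lieG R).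
  by congr pair; rewrite /= !scaler0 addr0.
have inr c s (X Y : su2 R) :
    (0, c *: X + s *: Y) = c *: ((0, X) : lieG R) + s *: ((0, Y) : lieG R).
  by congr pair; rewrite /= !scaler0 addr0.
have g23 : g (e2, 0) (0, f3) = 0 by rewrite inl inr !dotE -[RHS]h1; ring.
have g32 : g (e3, 0) (0, f2) = 0 by rewrite inl inr !dotE -[RHS]h2; ring.
have iso X Y : g (half_turnG e1 f1 X) (half_turnG e1 f1 Y) = g X Y.
  by rewrite -!sE; exact: spres.
have [d1 d2] := einstein_frame_diagonal lc ric eF fF iso g23 g32.
case: (eF) (fF) => [[_ ue2 ue3] [a12 a13 a23] _] [[_ uf2 uf3] [b12 b13 b23] _].
have [tau tA tE] := AdG_half_turnG ue2 uf2.
have tt : (tau \o tau)%VF = \1%VF.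
  by apply/lfunP => X; rewrite comp_lfunE id_lfunE !tE half_turnGK.
have st : (sigma \o tau)%VF = (tau \o sigma)%VF.
  apply/lfunP => X; rewrite !comp_lfunE !tE !sE /half_turnG /=.
  by rewrite (half_turnC _ a12) (half_turnC _ b12).
have nz (e : su2 R) : su2_dot e e = 1 -> e != - e.
  move=> u; apply/eqP => h; have := su2_dotNl e e; rewrite -{1}h u => /eqP.
  by rewrite -subr_eq0 opprK -mulr2n pnatr_eq0.
have t1 : tau != \1%VF.
  apply/eqP => h; have := congr1 (fun F : 'End(_) => (F (e1, 0)).1) h.
  rewrite id_lfunE tE /= half_turn_opp ?(su2_dotC e2) // => /esym/eqP.
  by rewrite (negPf (nz _ ue)).
have nst : sigma != tau.
  apply/eqP => h; have := congr1 (fun F : 'End(_) => (F (e1, 0)).1) h.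
  rewrite sE tE /= half_turn_fix // half_turn_opp ?(su2_dotC e2) // => /eqP.
  by rewrite (negPf (nz _ ue)).
have tpres : preserves_metric g tau.
  pose b := frameG e1 e2 e3 f1 f2 f3.
  (* the eigenvalues of tau on E1, E2, E3, F1, F2, F3 are -, +, -, -, +, - *)
  pose sg (i : 'I_6) := [:: true; false; true; true; false; true]`_i.
  have orth (X Y : lieG R) : sigma X = X -> sigma Y = - Y -> g X Y = 0.
    move=> hX hY; have := spres X Y; rewrite hX hY dotNr => /eqP.
    by rewrite eqNr => /eqP.
  have sp : [/\ sigma (e1, 0) = (e1, 0), sigma (0, f1) = (0, f1),
      sigma (e2, 0) = - (e2, 0) & sigma (0, f2) = - (0, f2)].
    rewrite !sE /half_turnG /= !half_turn0 !half_turn_fix // !half_turn_opp //.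
    by split=> //; congr pair; rewrite oppr0.
  case: sp => sp1 sp2 sp3 sp4.
  apply: (@frame_signs_isometry R g tau b (fun v i => lieG_dot v (b i)) sg).
  - by move=> k X Y; rewrite linearP.
  - exact: frameG_expand eF fF.
  - move=> i; rewrite tE /b /frameG /sg; case: i => [[|[|[|[|[|[|//]]]]]] ?] /=;
      rewrite /half_turnG /= ?half_turn0 ?half_turn_fix // ?half_turn_opp //
        ?(su2_dotC e2) ?(su2_dotC f2) // ?expr0 ?expr1 ?scale1r ?scaleN1r //;
      by congr pair; rewrite oppr0.
  move=> i j; rewrite /b /frameG /sg.
  case: i => [[|[|[|[|[|[|//]]]]]] ?] //=; case: j => [[|[|[|[|[|[|//]]]]]] ?] //= _ _;
    rewrite ?(orth _ _ sp1 sp3) ?(orth _ _ sp1 sp4) ?(orth _ _ sp2 sp3) ?(orth _ _ sp2 sp4) //.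
  - by rewrite dotC.
  - by rewrite dotC.
  - by rewrite dotC.
exists tau; split=> //.
  exact: klein_four_commuting.
move=> k /(generated_commuting ss tt st) [] ->.
- split; first by rewrite -ss; exact: AdG_comp.
  by move=> X Y; rewrite !id_lfunE.
- by split.
- by split.
split; first exact: AdG_comp.
by move=> X Y; rewrite !comp_lfunE spres tpres.
Qed.
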